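(* Let $\mu$ be a Borel measure on $M^*$ and let $\mathcal{H}=\int^\oplus_{M^*}\mathrm{d}\mu(p)\,H_p$ be a direct integral of separable Hilbert spaces $H_p$ with scalar products $\langle\cdot,\cdot\rangle_p$. Let $\Phi$ be a field on $\mathcal{H}$ with common dense domain $D$, and let $U$ be the representation of the translation group $M$ on $\mathcal{H}$ given by $(U(a)\varphi)(p)=e^{\mathrm{i}a\cdot p}\varphi(p)$. Suppose $\Phi$ is covariant under $U$, i.e. $U(a)D=D$ and $U(a)\Phi(f)U(a)^{-1}=\Phi(\{a\}f)$ on $D$ for all $a\in M$ and $f\in\mathcal{S}(M)$, where $(\{a\}f)(x)=f(x-a)$. Let $\Omega\in D$ satisfy $U(a)\Omega=\Omega$ for all $a\in M$. Then there are vectors $\Gamma(p)\in H_p$ such that $p\mapsto\Gamma(p)$ is weakly Borel and for every $f\in\mathcal{S}(M)$, \[ \big(\Phi(f)\Omega\big)(p)=\hat f(p)\,\Gamma(p) \] (as elements of $\mathcal{H}$, i.e. for $\mu$-almost all $p$).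
   Context: $M$ is four-dimensional Minkowski spacetime with Lorentz product $x\cdot y$ of signature $(-,+,+,+)$; $M^*$ is its dual, identified with $M$ via the Lorentz product, and $p\cdot x$ denotes the pairing. $\mathcal{S}(M)$ is the Schwartz space. The Fourier transform is $\hat f(p)=\int_M \mathrm{d}^4x\, e^{\mathrm{i}p\cdot x}f(x)$. Direct integral: the support of $\mu$ is partitioned into Borel sets $X_n$, $n=\omega,1,2,\dots$, with $H_p=\mathbb{C}^n$ for $p\in X_n$ ($n$ finite) and $H_p=\ell^2$ for $p\in X_\omega$; $\int^\oplus_{M^*}\mathrm{d}\mu(p)H_p$ is the Hilbert space of (equivalence classes, modulo $\mu$-a.e. equality) of functions $\varphi$ with $\varphi(p)\in H_p$, $p\mapsto\langle v,\varphi(p)\rangle_p$ measurable on each $X_n$ for every $v\in H_n$, and $\int\mathrm{d}\mu(p)\|\varphi(p)\|_p^2<\infty$, with scalar product $\langle\varphi,\psi\rangle=\int\mathrm{d}\mu(p)\langle\varphi(p),\psi(p)\rangle_p$. A map $p\mapsto u(p)\in H_p$ is weakly Borel if $p\mapsto\langle v,u(p)\rangle_p$ is Borel on each $X_n$ for every $v\in H_n$. A field on a Hilbert space $\mathcal{H}$ is an operator-valued distribution: a map $f\mapsto\Phi(f)$ assigning to each $f\in\mathcal{S}(M)$ a linear operator $\Phi(f)$, all defined on a common dense domain $D$, such that $f\mapsto\langle\varphi,\Phi(f)\psi\rangle$ is linear and continuous on $\mathcal{S}(M)$ for all $\varphi,\psi\in D$. *)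

(* Defs.v *)
From HB Require Import structures.
From mathcomp Require Import all_boot all_order all_algebra.
From mathcomp Require Import all_classical all_reals all_analysis.
From mathcomp Require Import complex.
Import Order.TTheory GRing.Theory Num.Theory.
Import numFieldNormedType.Exports.

Set Implicit Arguments.
Unset Strict Implicit.
Unset Printing Implicit Defensive.

Local Open Scope classical_set_scope.
Local Open Scope ring_scope.
Local Open Scope complex_scope.

(** Minkowski space M = R^4 (and its dual, identified with it), with
    coordinates (x0, x1, x2, x3) = ((x.1.1, x.1.2), (x.2.1, x.2.2)).
    Mn R carries the topology/normed structure (used for derivatives);
    Mb R is the same set carrying the Borel sigma-algebra of R^4 (product of
    the Borel sigma-algebras of the factors, on which Lebesgue measure lives). *)
Notation Mn R := ((R * R) * (R * R))%type.
Notation Mb R := ((measurableTypeR R * measurableTypeR R) *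
                  (measurableTypeR R * measurableTypeR R))%type.
Notation Cx R := (R[i]).

Section Defs.
Variable R : realType.
Local Notation M := (Mn R).
Local Notation MB := (Mb R).
Local Notation C := (Cx R).

Definition cRe (z : C) : R := complex.Re z.
Definition cIm (z : C) : R := complex.Im z.
Definition cmk (a b : R) : C := (a +i* b)%C.
Definition cconj (z : C) : C := cmk (cRe z) (- cIm z).
Definition cabs2 (z : C) : R := cRe z ^+ 2 + cIm z ^+ 2.
Definition expi (t : R) : C := cmk (cos t) (sin t).

Definition coord (x : M) (i : 'I_4) : R :=
  match val i with
  | 0 => x.1.1 | 1 => x.1.2 | 2 => x.2.1 | _ => x.2.2 end.
Definition lorentz (x y : M) : R :=
  - (x.1.1 * y.1.1) + x.1.2 * y.1.2 + x.2.1 * y.2.1 + x.2.2 * y.2.2.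
Definition eucl2 (x : M) : R :=
  x.1.1 ^+ 2 + x.1.2 ^+ 2 + x.2.1 ^+ 2 + x.2.2 ^+ 2.
Definition basis (i : 'I_4) : M :=
  match val i with
  | 0 => ((1, 0), (0, 0)) | 1 => ((0, 1), (0, 0))
  | 2 => ((0, 0), (1, 0)) | _ => ((0, 0), (0, 1)) end.

Definition leb := (@lebesgue_measure R).
Definition int4 (g : M -> R) : R :=
  Rintegral leb setT (fun x0 : measurableTypeR R =>
  Rintegral leb setT (fun x1 : measurableTypeR R =>
  Rintegral leb setT (fun x2 : measurableTypeR R =>
  Rintegral leb setT (fun x3 : measurableTypeR R =>
    g ((x0, x1), (x2, x3)))))).

Fixpoint pderiv (l : seq 'I_4) (g : M -> R) : M -> R :=
  match l with
  | [::] => g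
  | i :: l' => fun x => 'D_(basis i) (pderiv l' g) x
  end.

Definition smooth (g : M -> R) : Prop :=
  forall (l : seq 'I_4) (i : 'I_4) (x : M), derivable (pderiv l g) x (basis i).

Definition rapid_decrease (g : M -> R) : Prop :=
  forall (l : seq 'I_4) (k : nat), exists c : R,
    forall x : M, (1 + eucl2 x) ^+ k * `|pderiv l g x| <= c.

Definition schwartz (f : M -> C) : Prop :=
  smooth (cRe \o f) /\ smooth (cIm \o f) /\
  rapid_decrease (cRe \o f) /\ rapid_decrease (cIm \o f).

Definition sconv_real (g : nat -> M -> R) (g0 : M -> R) : Prop :=
  forall (l : seq 'I_4) (k : nat) (e : R), 0 < e ->
    \forall n \near \oo, forall x : M,
      (1 + eucl2 x) ^+ k * `|pderiv l (g n) x - pderiv l g0 x| <= e.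
Definition schwartz_cvg (f : nat -> M -> C) (f0 : M -> C) : Prop :=
  sconv_real (fun n => cRe \o f n) (cRe \o f0) /\
  sconv_real (fun n => cIm \o f n) (cIm \o f0).

Definition ccvg (u : nat -> C) (z : C) : Prop :=
  ((fun n => cRe (u n)) @ \oo --> cRe z) /\ ((fun n => cIm (u n)) @ \oo --> cIm z).

Definition fourier (f : M -> C) (p : M) : C :=
  cmk (int4 (fun x => cRe (expi (lorentz p x) * f x)))
      (int4 (fun x => cIm (expi (lorentz p x) * f x))).

Definition translate (a : M) (f : M -> C) : M -> C := fun x => f (x - a).

(** ---- Fibres.  Vectors of H_p are represented as sequences nat -> C.
    Dimension index: None = omega (H = l^2), Some n = dimension n.+1
    (H = C^(n+1), embedded as sequences vanishing from index n.+1 on). *)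
Definition seqv := nat -> C.

Definition sqnorm (v : seqv) : \bar R :=
  (\sum_(0 <= j <oo) (cabs2 (v j))%:E)%E.

Definition inH (o : option nat) (v : seqv) : Prop :=
  match o with
  | None => (sqnorm v < +oo)%E
  | Some n => forall j, (n < j)%N -> v j = 0
  end.

Definition fip (v w : seqv) : C :=
  cmk (limn (series (fun j => cRe (cconj (v j) * w j))))
      (limn (series (fun j => cIm (cconj (v j) * w j)))).

Definition msupport (mu : set MB -> \bar R) : set MB :=
  [set p | forall U : set M, open U -> U p -> (0 < mu U)%E].

Definition dim_partition (mu : set MB -> \bar R) (X : option nat -> set MB) : Prop :=
  (forall o, measurable (X o)) /\
  (forall o o', o <> o' -> X o `&` X o' = set0) /\
  (\bigcup_o X o = msupport mu).

Definition in_fibres (X : option nat -> set MB) (u : MB -> seqv) : Prop :=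
  forall o p, X o p -> inH o (u p).

Definition weakly_borel (X : option nat -> set MB) (u : MB -> seqv) : Prop :=
  forall o (v : seqv), inH o v ->
    measurable_fun (X o) (fun p => cRe (fip v (u p))) /\
    measurable_fun (X o) (fun p => cIm (fip v (u p))).

(** Vectors of the direct integral (representatives of its elements). *)
Definition dirint (mu : {measure set MB -> \bar R}) (X : option nat -> set MB)
    (phi : MB -> seqv) : Prop :=
  in_fibres X phi /\ weakly_borel X phi /\
  (\int[mu]_p sqnorm (phi p) < +oo)%E.

(** Equality in H: mu-almost everywhere equality of representatives. *)
Definition aeeq (mu : {measure set MB -> \bar R}) (phi psi : MB -> seqv) : Prop :=
  {ae mu, forall p, phi p = psi p}.

Definition vadd (phi psi : MB -> seqv) : MB -> seqv := fun p j => phi p j + psi p j.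
Definition vscale (c : C) (phi : MB -> seqv) : MB -> seqv := fun p j => c * phi p j.
Definition vsub (phi psi : MB -> seqv) : MB -> seqv := vadd phi (vscale (-1) psi).

Definition hip (mu : {measure set MB -> \bar R}) (phi psi : MB -> seqv) : C :=
  cmk (Rintegral mu setT (fun p => cRe (fip (phi p) (psi p))))
      (Rintegral mu setT (fun p => cIm (fip (phi p) (psi p)))).

Definition hnorm2 (mu : {measure set MB -> \bar R}) (phi : MB -> seqv) : \bar R :=
  (\int[mu]_p sqnorm (phi p))%E.

(** D is a dense linear subspace of H (given as a set of representatives,
    closed under mu-a.e. equality, i.e. a set of elements of H). *)
Definition dense_domain (mu : {measure set MB -> \bar R}) (X : option nat -> set MB)
    (D : set (MB -> seqv)) : Prop :=
  [/\ D `<=` dirint mu X,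
     (forall phi psi, D phi -> dirint mu X psi -> aeeq mu phi psi -> D psi),
     (exists phi, D phi),
     (forall phi psi c d, D phi -> D psi -> D (vadd (vscale c phi) (vscale d psi))) &
     (forall phi (e : R), dirint mu X phi -> 0 < e ->
        exists psi, D psi /\ (hnorm2 mu (vsub phi psi) < e%:E)%E)].

Definition operators_on (mu : {measure set MB -> \bar R}) (X : option nat -> set MB)
    (D : set (MB -> seqv)) (Phi : (M -> C) -> (MB -> seqv) -> (MB -> seqv)) : Prop :=
  forall f, schwartz f ->
    [/\ (forall phi, D phi -> dirint mu X (Phi f phi)),
        (forall phi psi, D phi -> D psi -> aeeq mu phi psi ->
           aeeq mu (Phi f phi) (Phi f psi)) &
        (forall c d phi psi, D phi -> D psi ->
           aeeq mu (Phi f (vadd (vscale c phi) (vscale d psi)))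
                   (vadd (vscale c (Phi f phi)) (vscale d (Phi f psi))))].

Definition is_field (mu : {measure set MB -> \bar R}) (X : option nat -> set MB)
    (D : set (MB -> seqv)) (Phi : (M -> C) -> (MB -> seqv) -> (MB -> seqv)) : Prop :=
  [/\ dense_domain mu X D,
      operators_on mu X D Phi,
     (forall phi psi f g (c d : C), D phi -> D psi -> schwartz f -> schwartz g ->
        hip mu phi (Phi (fun x => c * f x + d * g x) psi)
        = c * hip mu phi (Phi f psi) + d * hip mu phi (Phi g psi)) &
     (forall phi psi (fs : nat -> M -> C) f, D phi -> D psi ->
        (forall n, schwartz (fs n)) -> schwartz f -> schwartz_cvg fs f ->
        ccvg (fun n => hip mu phi (Phi (fs n) psi)) (hip mu phi (Phi f psi)))].

Definition Utr (a : M) (phi : MB -> seqv) : MB -> seqv :=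
  fun p j => expi (lorentz a p) * phi p j.

End Defs.

(* Main.v *)
Require Import Defs.
From HB Require Import structures.
From mathcomp Require Import all_boot all_order all_algebra.
From mathcomp Require Import all_classical all_reals all_analysis.
From mathcomp Require Import measurable_realfun.
From mathcomp Require Import complex.
From mathcomp Require Import ring lra zify.
Import Order.TTheory GRing.Theory Num.Theory.
Import numFieldNormedType.Exports.
Local Open Scope classical_set_scope.
Local Open Scope ring_scope.
Set Implicit Arguments.
Unset Strict Implicit.
Unset Printing Implicit Defensive.

(** Write [T f] for [Phi f Omega].  Covariance and the invariance of [Omega]
    give [T (translate a f) = exp (i a.p) T f].  If [g] is the Gaussian, the
    convolution of [f] and [g] is a limit of linear combinations of translates
    of [f] with weights sampled from [g], and also of translates of [g] with
    weights sampled from [f]; hence [T (f * g)] equals both [ghat * T f] and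
    [fhat * T g].  As [ghat] is positive everywhere, [Gamma := T g / ghat] is
    the required vector.

    The convolution itself is never formed: it suffices that the difference of
    the two Riemann sums over the lattice [h Z^4] tends to 0 in the Schwartz
    topology.  At lattice points the two sums differ only by truncation terms,
    in between the mean value theorem applies, and derivatives are controlled
    by interpolation between the function and its second derivatives. *)

(** * Polynomial weights and Peetre's inequality *)

Section Weights.
Variable R : realType.
Local Notation M := (Mn R).
Implicit Types x y : M.

(** The field is continuous only in its matrix elements: Schwartz convergence controls
    [hip mu psi (Phi f Omega)] for [psi] in [D], not [Phi f Omega] as a vector. The equality of
    [ghat * T f] and [fhat * T g] is therefore first obtained against a fixed [psi]; their
    difference is a square-integrable vector orthogonal to a dense subspace, hence zero almost
    everywhere. Real parts of the pairings suffice for this. The null set may depend on [f], but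
    [Gamma] is built once from the Gaussian, so no exceptional sets have to be merged over the test
    functions. Dividing by [ghat] may destroy square integrability, which is why [Gamma] is only a
    weakly Borel family. Comparing two Riemann sums with each other, instead of each with a
    convolution, spares differentiation under the integral and exchange of integrals for the
    convolution. A second obstacle is measure-theoretic: representatives are controlled only on the
    fibres, which cover just the support of [mu]. That the rest is null comes from a countable base
    of the topology. *)

Definition wt x : R := 1 + eucl2 x.

Lemma eucl2_ge0 x : 0 <= eucl2 x.
Proof. by rewrite /eucl2 !addr_ge0 ?sqr_ge0. Qed.

Lemma wt_ge1 x : 1 <= wt x.
Proof. by rewrite lerDl eucl2_ge0. Qed.

Lemma wt_gt0 x : 0 < wt x.
Proof. exact: lt_le_trans ltr01 (wt_ge1 x). Qed.

Lemma wtX_ge1 x k : 1 <= wt x ^+ k.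
Proof. by rewrite exprn_ege1 ?wt_ge1. Qed.

Lemma wtX_gt0 x k : 0 < wt x ^+ k.
Proof. by rewrite exprn_gt0 ?wt_gt0. Qed.

(** Peetre's inequality: [eucl2 (x + y)] is at most [2 * eucl2 x + 2 * eucl2 y], which the product
    absorbs. It lets the weight at [x] be shared between [y] and [x - y] in a convolution. *)
Lemma peetre x y : wt (x + y) <= 2 * wt x * wt y.
Proof.
have := eucl2_ge0 x; have := eucl2_ge0 y.
rewrite /wt /eucl2 /=; move: x.1.1 x.1.2 x.2.1 x.2.2 y.1.1 y.1.2 y.2.1 y.2.2.
move=> a b c d a' b' c' d' h1 h2.
have h3 := mulr_ge0 h2 h1.
have := sqr_ge0 (a - a'); have := sqr_ge0 (b - b').
have := sqr_ge0 (c - c'); have := sqr_ge0 (d - d').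
by nra.
Qed.

Lemma peetreX x y k : wt (x + y) ^+ k <= 2 ^+ k * wt x ^+ k * wt y ^+ k.
Proof.
rewrite -!exprMn lerXn2r ?nnegrE ?peetre ?ltW ?wt_gt0 //.
by rewrite !mulr_gt0 ?wt_gt0.
Qed.

Definition fast_decay (u : M -> R) : Prop :=
  forall k, exists2 c, 0 <= c & forall x, wt x ^+ k * `|u x| <= c.

(** Unlike [wt], this weight factors over the coordinates, so lattice sums and iterated integrals
    against its inverse reduce to one dimension. *)
Definition prod4 x : R :=
  (1 + x.1.1 ^+ 2) * (1 + x.1.2 ^+ 2) * ((1 + x.2.1 ^+ 2) * (1 + x.2.2 ^+ 2)).

Lemma oneDsq_gt0 (t : R) : 0 < 1 + t ^+ 2.
Proof. by rewrite ltr_pwDl ?sqr_ge0. Qed.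

Lemma prod4_gt0 x : 0 < prod4 x.
Proof. by rewrite !mulr_gt0 ?oneDsq_gt0. Qed.

Lemma prod4_le x : prod4 x <= wt x ^+ 4.
Proof.
have p (t : R) : 1 + t ^+ 2 \is Num.nneg by rewrite nnegrE ltW ?oneDsq_gt0.
have l1 : 1 + x.1.1 ^+ 2 <= wt x.
  by rewrite /wt /eucl2 -!addrA !lerD2l lerDl !addr_ge0 ?sqr_ge0.
have l2 : 1 + x.1.2 ^+ 2 <= wt x.
  by have := sqr_ge0 x.1.1; have := sqr_ge0 x.2.1; have := sqr_ge0 x.2.2;
     rewrite /wt /eucl2; lra.
have l3 : 1 + x.2.1 ^+ 2 <= wt x.
  by have := sqr_ge0 x.1.1; have := sqr_ge0 x.1.2; have := sqr_ge0 x.2.2;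
     rewrite /wt /eucl2; lra.
have l4 : 1 + x.2.2 ^+ 2 <= wt x.
  by have := sqr_ge0 x.1.1; have := sqr_ge0 x.1.2; have := sqr_ge0 x.2.1;
     rewrite /wt /eucl2; lra.
have -> : wt x ^+ 4 = wt x * wt x * (wt x * wt x) by ring.
by rewrite /prod4 !ler_pM ?mulr_ge0 // ?p -?nnegrE ?p.
Qed.

Lemma fast_decay_prod4 u : fast_decay u ->
  exists2 c, 0 <= c & forall x, `|u x| <= c / prod4 x.
Proof.
move=> /(_ 4%N)[c c0 hc]; exists c => // x.
rewrite ler_pdivlMr ?prod4_gt0 // mulrC; apply: le_trans (hc x).
by rewrite ler_wpM2r // prod4_le.
Qed.

End Weights.

(** * Lattice sums approximating a convolution, and the effect of exchanging the factors *)

Section Lattice.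
Variable R : realType.
Local Notation M := (Mn R).
Implicit Types x y : M.

Definition mesh (n : nat) : R := n.+1%:R^-1.

Lemma mesh_gt0 n : 0 < mesh n. Proof. by rewrite invr_gt0. Qed.
Lemma mesh_le1 n : mesh n <= 1.
Proof. by rewrite invf_le1 // ler1n. Qed.

(* With mesh [1 / (n + 1)], the lattice points [j h] with [|j| <= (n + 1)^2] fill
   [[-(n + 1), n + 1]]. *)
Definition line (n : nat) : seq int :=
  [seq i%:Z - (n.+1 ^ 2)%N%:Z | i <- iota 0 (n.+1 ^ 2).*2.+1].

Lemma mem_line n j : (j \in line n) = (`|j| <= (n.+1 ^ 2)%N).
Proof.
apply/mapP/idP => [[m]|jn].
  rewrite mem_iota => /andP[_ ml] ->; lia.
exists (absz ((j : int) + (n.+1 ^ 2)%N%:Z)); first by rewrite mem_iota; lia.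
by lia.
Qed.

Lemma line_uniq n : uniq (line n).
Proof. by rewrite map_inj_uniq ?iota_uniq // => i j /addIr[]. Qed.

Definition box (n : nat) : seq ((int * int) * (int * int)) :=
  let l := [seq (a, b) | a <- line n, b <- line n] in
  [seq (a, b) | a <- l, b <- l].

Lemma mem_box n j : (j \in box n) =
  [&& j.1.1 \in line n, j.1.2 \in line n, j.2.1 \in line n & j.2.2 \in line n].
Proof.
have p (T S : eqType) (s : seq T) (t : seq S) a b :
    ((a, b) \in [seq (a, b) | a <- s, b <- t]) = (a \in s) && (b \in t).
  apply/allpairsP/andP => [[[c d] /= [? ? [-> ->]]] // | [? ?]].
  by exists (a, b).
by case: j => -[a b] [c d]; rewrite /box !p -!andbA.
Qed.

Lemma box_uniq n : uniq (box n).
Proof.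
have p (T S : eqType) (s : seq T) (t : seq S) : uniq s -> uniq t ->
    uniq [seq (a, b) | a <- s, b <- t].
  move=> us ut; apply: allpairs_uniq => //.
  by move=> [a b] [c d] _ _ /= [-> ->].
by rewrite /box; apply: (p); apply: p; exact: line_uniq.
Qed.

Lemma sum_box (V : nmodType) n (F : (int * int) * (int * int) -> V) :
  \sum_(j <- box n) F j = \sum_(a <- line n) \sum_(b <- line n)
    \sum_(c <- line n) \sum_(d <- line n) F ((a, b), (c, d)).
Proof.
rewrite /box big_allpairs big_allpairs.
apply: eq_bigr => a _; apply: eq_bigr => b _.
by rewrite big_allpairs.
Qed.

Definition lat1 (n : nat) (j : int) : R := j%:~R * mesh n.

Definition lat (n : nat) (j : (int * int) * (int * int)) : M :=
  ((lat1 n j.1.1, lat1 n j.1.2), (lat1 n j.2.1, lat1 n j.2.2)).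

Lemma latB n j k : lat n (j - k) = lat n j - lat n k.
Proof. by rewrite /lat /lat1 /= !rmorphB /= !mulrBl. Qed.

(* Primitive-like comparison: [t / (1 + |t|)] is bounded by 1 and its increments
   over one mesh dominate a quarter of [h / (1 + t^2)]. *)
Lemma sum_line_oneDsq n :
  \sum_(j <- line n) mesh n / (1 + lat1 n j ^+ 2) <= 8.
Proof.
pose A (t : R) := t / (1 + `|t|).
have A1 t : `|A t| <= 1.
  have t0 : 0 < 1 + `|t| by rewrite ltr_pwDl.
  by rewrite normrM normfV (gtr0_norm t0) ler_pdivrMr // mul1r lerDr.
have h0 := mesh_gt0 n; have h1 := mesh_le1 n.
have step (j : int) : mesh n / (1 + lat1 n j ^+ 2) <=
    4 * (A (lat1 n (j + 1)) - A (lat1 n j)).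
  have -> : lat1 n (j + 1) = lat1 n j + mesh n.
    by rewrite /lat1 rmorphD /= mulrDl mul1r.
  have tE : lat1 n j = j%:~R * mesh n by [].
  (* As 0 is a lattice point, no mesh interval contains it in its interior, so both absolute values
     in [A] open with the same sign. *)
  case: (lerP 0 j) => j0.
    have t0 : 0 <= lat1 n j by rewrite tE mulr_ge0 ?ler0z // ltW.
    move: (lat1 n j) (mesh n) t0 h0 h1 => {tE} t h t0 h0 h1.
    rewrite /A !ger0_norm ?addr_ge0 ?(ltW h0) //.
    have -> : (t + h) / (1 + (t + h)) - t / (1 + t) =
        h / ((1 + t) * (1 + (t + h))).
      by field; rewrite !gt_eqF //; lra.
    have h2 : 0 < (1 + t) * (1 + (t + h)) by nra.
    have h3 : 0 < 1 + t ^+ 2 by nra.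
    rewrite mulrA ler_pdivrMr // mulrAC ler_pdivlMr // [4 * h]mulrC -[X in _ <= X]mulrA.
    by rewrite ler_pM2l //; have := sqr_ge0 (1 - t); nra.
  have t0 : lat1 n j + mesh n <= 0.
    have -> : lat1 n j + mesh n = (j + 1)%:~R * mesh n.
      by rewrite tE rmorphD /= mulrDl mul1r.
    by rewrite pmulr_lle0 // lerz0; lia.
  move: (lat1 n j) (mesh n) t0 h0 h1 => {tE} t h t0 h0 h1.
  rewrite /A !ler0_norm //; last lra.
  have -> : (t + h) / (1 - (t + h)) - t / (1 - t) =
      h / ((1 - t) * (1 - (t + h))).
    by field; rewrite !gt_eqF //; lra.
  have h2 : 0 < (1 - t) * (1 - (t + h)) by nra.
  have h3 : 0 < 1 + t ^+ 2 by nra.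
  rewrite mulrA ler_pdivrMr // mulrAC ler_pdivlMr // [4 * h]mulrC -[X in _ <= X]mulrA.
  by rewrite ler_pM2l //; have := sqr_ge0 (1 + t); nra.
apply: le_trans (ler_sum _ (fun j _ => step j)) _.
rewrite -mulr_sumr big_map.
set K := (n.+1 ^ 2)%N.
have -> : \sum_(i <- iota 0 K.*2.+1)
    (A (lat1 n (i%:Z - K%:Z + 1)) - A (lat1 n (i%:Z - K%:Z))) =
    \sum_(0 <= i < K.*2.+1) (A (lat1 n (i.+1%:Z - K%:Z)) - A (lat1 n (i%:Z - K%:Z))).
  rewrite /index_iota subn0; apply: eq_bigr => i _.
  by congr (A (lat1 n _) - _); lia.
rewrite (telescope_sumr (fun i : nat => A (lat1 n (i%:Z - K%:Z)))) //.
set a := A _; set b := A _.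
have := A1 (lat1 n (K.*2.+1%:Z - K%:Z)); have := A1 (lat1 n (0%:Z - K%:Z)).
rewrite -/a -/b !ler_norml => /andP[? ?] /andP[? ?]; lra.
Qed.

(** The box is a product of four lines and [prod4] factors, so the sum is the fourth power of the
    one-dimensional one. *)
Lemma sum_box_prod4 n :
  \sum_(j <- box n) mesh n ^+ 4 / prod4 (lat n j) <= 8 ^+ 4.
Proof.
pose F j := mesh n / (1 + lat1 n j ^+ 2).
have F0 j : 0 <= F j by rewrite divr_ge0 ?ltW ?mesh_gt0 ?oneDsq_gt0.
have -> : \sum_(j <- box n) mesh n ^+ 4 / prod4 (lat n j) =
    (\sum_(j <- line n) F j) ^+ 4.
  rewrite sum_box [RHS]exprS [in RHS]exprS [in RHS]expr2.
  rewrite mulr_suml; apply: eq_bigr => a _.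
  rewrite mulr_suml mulr_sumr; apply: eq_bigr => b _.
  rewrite mulr_suml !mulr_sumr; apply: eq_bigr => c _.
  rewrite !mulr_sumr; apply: eq_bigr => d _.
  rewrite /F /prod4 /=; field.
  by rewrite !gt_eqF ?oneDsq_gt0.
by rewrite lerXn2r ?nnegrE ?sumr_ge0 // sum_line_oneDsq.
Qed.

(** Riemann sum, with cells of volume [mesh n ^+ 4], of the convolution of [a] and [b] at [x]. *)
Definition lsum n (a b : M -> R) x :=
  \sum_(j <- box n) mesh n ^+ 4 * (a (lat n j) * b (x - lat n j)).

(** Peetre's inequality for [x = y + (x - y)] gives each factor its own [k] powers of the weight.
    The four extra powers asked of [a] dominate [prod4 y] and leave the summable [h / prod4 y]. *)
Lemma lsum_term (a b : M -> R) k ca d (h : R) x y : 0 <= h -> 0 <= ca -> 0 <= d ->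
  wt y ^+ (k + 4) * `|a y| <= ca -> wt (x - y) ^+ k * `|b (x - y)| <= d ->
  wt x ^+ k * `|h * (a y * b (x - y))| <= 2 ^+ k * ca * d * (h / prod4 y).
Proof.
move=> h0 ca0 d0 Ha Hb.
have p0 := prod4_gt0 y.
have H : wt (y + (x - y)) ^+ k * (`|a y| * `|b (x - y)|) <=
    2 ^+ k * ca * d / prod4 y.
  rewrite ler_pdivlMr //.
  apply: le_trans (_ : (2 ^+ k * wt y ^+ k * wt (x - y) ^+ k) *
     (`|a y| * `|b (x - y)|) * wt y ^+ 4 <= _).
    apply: ler_pM; rewrite ?(ltW p0) ?prod4_le //.
      by rewrite !mulr_ge0 // ltW // wtX_gt0.
    by rewrite ler_wpM2r ?mulr_ge0 ?peetreX.
  have -> : (2 ^+ k * wt y ^+ k * wt (x - y) ^+ k) *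
     (`|a y| * `|b (x - y)|) * wt y ^+ 4 =
     2 ^+ k * (wt y ^+ (k + 4) * `|a y|) * (wt (x - y) ^+ k * `|b (x - y)|).
    by rewrite exprD; ring.
  apply: ler_pM => //; rewrite ?mulr_ge0 ?exprn_ge0 // ?(ltW (wt_gt0 _)) //.
  by rewrite ler_wpM2l ?exprn_ge0.
have -> : x = y + (x - y) by rewrite addrC subrK.
rewrite addrAC subrr add0r.
rewrite !normrM (ger0_norm h0).
have -> : 2 ^+ k * ca * d * (h / prod4 y) = h * (2 ^+ k * ca * d / prod4 y).
  by ring.
by rewrite mulrCA ler_wpM2l.
Qed.

(** The filter [P] allows a bound [d] valid only at the retained points: without restriction it
    yields uniform boundedness, and on the points where [x - lat n j] leaves the box it yields
    smallness. *)
Lemma lsum_bound_gen n (P : pred ((int * int) * (int * int))) (a b : M -> R) k ca d x :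
  0 <= ca -> 0 <= d -> (forall y, wt y ^+ (k + 4) * `|a y| <= ca) ->
  (forall j, P j -> wt (x - lat n j) ^+ k * `|b (x - lat n j)| <= d) ->
  wt x ^+ k * `|\sum_(j <- box n | P j) mesh n ^+ 4 * (a (lat n j) * b (x - lat n j))|
    <= 2 ^+ k * ca * d * 8 ^+ 4.
Proof.
move=> ca0 d0 Ha Hb.
apply: le_trans (_ : wt x ^+ k * (\sum_(j <- box n | P j)
   `|mesh n ^+ 4 * (a (lat n j) * b (x - lat n j))|) <= _).
  by rewrite ler_wpM2l ?(ltW (wtX_gt0 _ _)) //; exact: ler_norm_sum.
rewrite mulr_sumr.
have m0 : 0 <= mesh n ^+ 4 by rewrite exprn_ge0 // ltW // mesh_gt0.
apply: le_trans (_ : \sum_(j <- box n | P j) 2 ^+ k * ca * d *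
   (mesh n ^+ 4 / prod4 (lat n j)) <= _).
  by apply: ler_sum => j Pj; apply: lsum_term => //; exact: Hb.
rewrite -mulr_sumr ler_wpM2l ?mulr_ge0 ?exprn_ge0 //.
apply: le_trans (sum_box_prod4 n); rewrite big_mkcond ler_sum // => j _.
by case: ifP => // _; rewrite divr_ge0 // ltW // prod4_gt0.
Qed.

Lemma lsum_bound (a b : M -> R) : fast_decay a -> fast_decay b ->
  forall k, exists2 c, 0 <= c & forall n x, wt x ^+ k * `|lsum n a b x| <= c.
Proof.
move=> ha hb k.
have [ca ca0 Ha] := ha (k + 4)%N; have [cb cb0 Hb] := hb k.
exists (2 ^+ k * ca * cb * 8 ^+ 4) => [|n x]; first by rewrite !mulr_ge0 ?exprn_ge0.
exact: lsum_bound_gen.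
Qed.

(** At a lattice point, [j] to [m - j] is an involution that exchanges the roles of [a] and [b].
    Terms with both [j] and [m - j] in the box cancel; what survives is due to truncation. *)
Lemma lsum_swap n (a b : M -> R) m :
  lsum n a b (lat n m) - lsum n b a (lat n m) =
  \sum_(j <- box n | m - j \notin box n)
     mesh n ^+ 4 * (a (lat n j) * b (lat n m - lat n j)) -
  \sum_(j <- box n | m - j \notin box n)
     mesh n ^+ 4 * (b (lat n j) * a (lat n m - lat n j)).
Proof.
rewrite /lsum (bigID (fun j => m - j \in box n)) /=.
rewrite [X in _ - X = _](bigID (fun j => m - j \in box n)) /=.
set A := \sum_(j <- _ | _ \in _) _; set A' := \sum_(j <- _ | _ \in _) _.
suff -> : A' = A by rewrite opprD addrACA subrr add0r.
rewrite /A /A' -[LHS]big_filter -[RHS]big_filter.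
set s := [seq i <- box n | _].
have ps : perm_eq s [seq m - j | j <- s].
  have us : uniq s by rewrite filter_uniq // box_uniq.
  have inj : injective (fun j => m - j) by move=> i j /addrI/oppr_inj.
  apply: uniq_perm => //; first by rewrite map_inj_uniq.
  move=> j; apply/idP/mapP.
    rewrite mem_filter => /andP[h1 h2].
    exists (m - j); last by rewrite opprB addrC subrK.
    by rewrite mem_filter h1 opprB addrC subrK h2.
  move=> [k]; rewrite !mem_filter => /andP[h1 h2] ->.
  by rewrite h1 opprB addrC subrK h2.
rewrite (perm_big _ ps) big_map; apply: eq_bigr => j _.
by rewrite !latB opprB (addrC (lat n m) (lat n j - _)) subrK [b _ * _]mulrC.
Qed.

(** Some index exceeds [(n + 1)^2], so the corresponding coordinate exceeds [n + 1], the inverse of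
    the mesh, in absolute value. *)
Lemma lat_notin_box n j : j \notin box n -> (mesh n)^-1 <= wt (lat n j).
Proof.
have key (c : int) : c \notin line n -> (mesh n)^-1 <= 1 + lat1 n c ^+ 2.
  rewrite mem_line -ltNge => hc.
  rewrite -[lat1 n c ^+ 2]real_normK ?num_real // normrM (gtr0_norm (mesh_gt0 n)).
  have h0 := mesh_gt0 n.
  have : (mesh n)^-1 <= `|c%:~R : R| * mesh n.
    rewrite -ler_pdivrMr // -intr_norm -expr2 /mesh invrK -natrX.
    by rewrite -[_%:R]/((Posz (n.+1 ^ 2))%:~R) ler_int ltW.
  have : 1 <= (mesh n)^-1 by rewrite invf_ge1 // mesh_le1.
  by move: (mesh n)^-1 (_ * mesh n) => u v; nra.
rewrite mem_box /= => hj.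
have := sqr_ge0 (lat n j).1.1; have := sqr_ge0 (lat n j).1.2.
have := sqr_ge0 (lat n j).2.1; have := sqr_ge0 (lat n j).2.2.
rewrite /wt /eucl2 /=.
move: hj; rewrite !negb_and => /or4P[] /key; lra.
Qed.

(** The truncation terms sample their second factor outside the box, where decay supplies a factor
    [mesh n]. The bound covers every lattice point, inside the box or not. *)
Lemma lsum_swap_small (a b : M -> R) : fast_decay a -> fast_decay b ->
  forall k, exists2 c, 0 <= c & forall n m,
    wt (lat n m) ^+ k * `|lsum n a b (lat n m) - lsum n b a (lat n m)| <= c * mesh n.
Proof.
move=> ha hb k.
(* One spare power of the weight ([k.+1] instead of [k]) is traded for the factor [mesh n]. *)
have far (u : M -> R) : fast_decay u -> exists2 c, 0 <= c & forall n j,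
    j \notin box n -> wt (lat n j) ^+ k * `|u (lat n j)| <= c * mesh n.
  move=> hu; have [c c0 Hc] := hu k.+1; exists c => // n j jn.
  rewrite -ler_pdivrMr ?mesh_gt0 //; apply: le_trans (Hc (lat n j)).
  rewrite exprS mulrC mulrA ler_wpM2r //.
  by rewrite ler_wpM2r ?lat_notin_box // ltW // wtX_gt0.
have [ca ca0 Ha] := ha (k + 4)%N; have [cb cb0 Hb] := hb (k + 4)%N.
have [da da0 Fa] := far _ ha; have [db db0 Fb] := far _ hb.
exists (2 ^+ k * ca * db * 8 ^+ 4 + 2 ^+ k * cb * da * 8 ^+ 4) => [|n m].
  by rewrite addr_ge0 // !mulr_ge0 ?exprn_ge0.
have m0 := ltW (mesh_gt0 n).
rewrite lsum_swap; apply: le_trans (ler_wpM2l _ (ler_normB _ _)) _.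
  by rewrite ltW // wtX_gt0.
rewrite mulrDr [X in _ <= X]mulrDl lerD //.
- have -> : 2 ^+ k * ca * db * 8 ^+ 4 * mesh n = 2 ^+ k * ca * (db * mesh n) * 8 ^+ 4.
    by ring.
  by apply: lsum_bound_gen => // [|j]; rewrite ?mulr_ge0 // -latB; exact: Fb.
- have -> : 2 ^+ k * cb * da * 8 ^+ 4 * mesh n = 2 ^+ k * cb * (da * mesh n) * 8 ^+ 4.
    by ring.
  by apply: lsum_bound_gen => // [|j]; rewrite ?mulr_ge0 // -latB; exact: Fa.
Qed.

End Lattice.

(** * Derivatives of lattice sums and convergence in the Schwartz topology *)

Section PartialDerivatives.
Variable R : realType.
Local Notation M := (Mn R).
Implicit Types (u a b : M -> R) (x y v : M).

Lemma is_derive_translate u y x v :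
  derivable u (x - y) v ->
  is_derive x v (fun z => u (z - y)) ('D_v u (x - y)).
Proof.
move=> du.
have E : (fun h : R => h^-1 *: (u (h *: v + x - y) - u (x - y))) =
    (fun h : R => h^-1 *: (u (h *: v + (x - y)) - u (x - y))).
  by apply/funext => h; rewrite addrA.
apply: DeriveDef; first by rewrite /derivable /= E; exact: du.
by rewrite /derive /= E.
Qed.

Lemma is_derive_lin2 u w (b c : R) x v : derivable u x v -> derivable w x v ->
  is_derive x v (fun z => b * u z + c * w z) (b * 'D_v u x + c * 'D_v w x).
Proof.
move=> du dw.
by apply: is_deriveD; apply: is_deriveZ; exact: derivableP.
Qed.

Lemma is_derive_lincomb (T : Type) (s : seq T) (c : T -> R) (y : T -> M) u x v :
  (forall z, derivable u z v) ->
  is_derive x v (fun z => \sum_(j <- s) c j * u (z - y j))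
    (\sum_(j <- s) c j * 'D_v u (x - y j)).
Proof.
move=> du; elim: s => [|j s IH].
  rewrite big_nil; have -> : (fun z => \sum_(j <- [::]) c j * u (z - y j)) = cst 0.
    by apply/funext => z; rewrite big_nil.
  exact: is_derive_cst.
have -> : (fun z => \sum_(i <- j :: s) c i * u (z - y i)) =
    (fun z => c j * u (z - y j)) + (fun z => \sum_(i <- s) c i * u (z - y i)).
  by apply/funext => z; rewrite big_cons.
rewrite big_cons; apply: is_deriveD.
by apply: is_deriveZ; exact: is_derive_translate.
Qed.

Lemma pderiv_lincomb (T : Type) (s : seq T) (c : T -> R) (y : T -> M) u l :
  smooth u -> pderiv l (fun z => \sum_(j <- s) c j * u (z - y j)) =
  fun z => \sum_(j <- s) c j * pderiv l u (z - y j).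
Proof.
move=> su; elim: l => //= i l ->; apply/funext => x.
by apply: (@derive_val _ _ _ _ _ _ _ (is_derive_lincomb _ _ _ _ _)) => z; exact: su.
Qed.

Lemma smooth_lincomb (T : Type) (s : seq T) (c : T -> R) (y : T -> M) u :
  smooth u -> smooth (fun z => \sum_(j <- s) c j * u (z - y j)).
Proof.
move=> su l i x; rewrite pderiv_lincomb //.
by apply: ex_derive; apply: is_derive_lincomb => z; exact: su.
Qed.

Lemma pderiv_lin2 u w (b c : R) l : smooth u -> smooth w ->
  pderiv l (fun z => b * u z + c * w z) =
  fun z => b * pderiv l u z + c * pderiv l w z.
Proof.
move=> su sw; elim: l => //= i l ->; apply/funext => x.
by apply: (@derive_val _ _ _ _ _ _ _ (is_derive_lin2 _ _ _ _)).
Qed.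

Lemma smooth_lin2 u w (b c : R) : smooth u -> smooth w ->
  smooth (fun z => b * u z + c * w z).
Proof.
move=> su sw l i x; rewrite pderiv_lin2 //.
by apply: ex_derive; apply: is_derive_lin2.
Qed.

Lemma pderiv_cst0 l : pderiv l (fun=> 0 : R) = fun=> 0.
Proof. by elim: l => //= i l ->; apply/funext => x; rewrite derive_cst. Qed.

Lemma fast_decay_pderiv u l : rapid_decrease u -> fast_decay (pderiv l u).
Proof.
move=> ru k; have [c hc] := ru l k; exists c => //.
by apply: le_trans (hc 0); rewrite mulr_ge0 // ltW // wtX_gt0.
Qed.

Lemma mvt_basis u i x (t : R) : (forall z, derivable u z (Defs.basis R i)) -> 0 <= t ->
  exists2 s, 0 <= s <= t &
    u (x + t *: Defs.basis R i) - u x = t * 'D_(Defs.basis R i) u (x + s *: Defs.basis R i).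
Proof.
move=> du t0; set e := Defs.basis R i.
have dF (s : R) : is_derive s 1 (fun r : R => u (x + r *: e)) ('D_e u (x + s *: e)).
  have E : (fun h : R => h^-1 *: (u (x + (h *: (1 : R) + s) *: e) - u (x + s *: e))) =
      (fun h : R => h^-1 *: (u (h *: e + (x + s *: e)) - u (x + s *: e))).
    apply/funext => h; congr (_ *: (u _ - _)).
    by rewrite [h *: 1]mulr1 scalerDl addrCA.
  apply: DeriveDef; first by rewrite /derivable /= E; exact: du.
  by rewrite /derive /= E.
have [|s] := @MVT_segment R (fun r => u (x + r *: e)) (fun r => 'D_e u (x + r *: e)) 0 t t0.
  apply: derivable_within_continuous => r _; exact: (@ex_derive _ _ _ _ _ _ _ (dF r)).
rewrite in_itv /= subr0 scale0r addr0 => hs ->; exists s => //.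
by rewrite mulrC.
Qed.

Lemma wt_basis i (t : R) : wt (t *: Defs.basis R i) = 1 + t ^+ 2.
Proof.
have s1 : t *: (1 : R) = t by exact: mulr1.
by rewrite /wt /eucl2 /Defs.basis; case: i => -[|[|[|[|]]]] //= ?;
  rewrite !s1 !scaler0 !expr0n /= ?(add0r, addr0).
Qed.

(** Peetre's inequality contributes a factor 2, and the displacement, of length at most 1, has
    weight at most 2; hence the 4. *)
Lemma wt_shift i x (s t : R) k : 0 <= s <= 1 -> 0 <= t <= 1 ->
  wt (x + t *: Defs.basis R i) ^+ k <= 4 ^+ k * wt (x + s *: Defs.basis R i) ^+ k.
Proof.
move=> s01 t01.
have -> : x + t *: Defs.basis R i = (t - s) *: Defs.basis R i + (x + s *: Defs.basis R i).
  by rewrite scalerBl addrA (addrC _ x) addrA subrK.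
apply: le_trans (peetreX _ _ _) _.
rewrite ler_wpM2r ?(ltW (wtX_gt0 _ _)) // -exprMn lerXn2r ?nnegrE //.
  by rewrite mulr_ge0 // ltW // wt_gt0.
have -> : 4 = 2 * 2 :> R by ring.
by rewrite ler_pM2l // wt_basis; nra.
Qed.

(** Landau's inequality with weights. The mean value theorem for [u] finds a point at distance
    [s <= d] where the derivative equals the difference quotient; applied to the derivative, it
    returns to [x] at the cost of [s] times a second derivative. *)
Lemma landau_interpolation u i k (e B d : R) : (forall z, derivable u z (Defs.basis R i)) ->
  (forall z, derivable ('D_(Defs.basis R i) u) z (Defs.basis R i)) ->
  (forall x, wt x ^+ k * `|u x| <= e) ->
  (forall x, wt x ^+ k * `|'D_(Defs.basis R i) ('D_(Defs.basis R i) u) x| <= B) ->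
  0 < d <= 1 ->
  forall x, wt x ^+ k * `|'D_(Defs.basis R i) u x| <= 4 ^+ k * (2 * e / d + d * B).
Proof.
move=> du ddu He HB /andP[d0 d1] x; set b := Defs.basis R i.
have [s s01 Es] := mvt_basis x du (ltW d0).
have /andP[s0 sd] := s01.
have [r /andP[r0 rs] Er] := mvt_basis x ddu s0.
have -> : 'D_b u x = (u (x + d *: b) - u x) / d - s * 'D_b ('D_b u) (x + r *: b).
  by rewrite -Er Es mulrAC divff ?gt_eqF // mul1r opprB addrCA subrr addr0.
set z1 := x + d *: b; set z2 := x + r *: b.
have K1 (t : R) : 0 <= t <= 1 -> wt x ^+ k <= 4 ^+ k * wt (x + t *: b) ^+ k.
  move=> t01; have := @wt_shift i x t 0 k t01; rewrite scale0r addr0; apply.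
  by rewrite lexx ler01.
have h1 : wt x ^+ k * `|u z1| <= 4 ^+ k * e.
  apply: le_trans (_ : 4 ^+ k * wt z1 ^+ k * `|u z1| <= _).
    by rewrite ler_wpM2r // K1 // d1 ltW.
  by rewrite -mulrA ler_wpM2l ?exprn_ge0.
have h2 : wt x ^+ k * `|u x| <= 4 ^+ k * e.
  apply: le_trans (_ : 4 ^+ k * wt x ^+ k * `|u x| <= _).
    by rewrite ler_wpM2r // ler_peMl ?(ltW (wtX_gt0 _ _)) // exprn_ege1 // ler1n.
  by rewrite -mulrA ler_wpM2l ?exprn_ge0.
have h3 : wt x ^+ k * `|'D_b ('D_b u) z2| <= 4 ^+ k * B.
  apply: le_trans (_ : 4 ^+ k * wt z2 ^+ k * `|'D_b ('D_b u) z2| <= _).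
    by rewrite ler_wpM2r // K1 // r0 (le_trans rs) // (le_trans sd).
  by rewrite -mulrA ler_wpM2l ?exprn_ge0.
have w0 := ltW (wtX_gt0 x k).
apply: le_trans (ler_wpM2l w0 (ler_normB _ _)) _.
rewrite mulrDr [X in _ <= X]mulrDr lerD //.
  rewrite normrM normfV (gtr0_norm d0) mulrA [X in _ <= X]mulrA.
  rewrite ler_wpM2r ?invr_ge0 ?(ltW d0) //.
  apply: le_trans (ler_wpM2l w0 (ler_normB _ _)) _.
  rewrite mulrDr; move: h1 h2; rewrite -/z1.
  by move: (wt x ^+ k * `|u z1|) (wt x ^+ k * `|u x|) => p q; lra.
rewrite normrM (ger0_norm s0) mulrCA [X in _ <= X]mulrCA.
by apply: ler_pM => //; rewrite ?mulr_ge0.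
Qed.

(** Induction on the list of derivatives: since the bounds on two further derivatives are uniform in
    [n], interpolation passes smallness from [pderiv l] to one more derivative. *)
Lemma sconv_real0 (D : nat -> M -> R) :
  (forall n, smooth (D n)) ->
  (forall l k, exists2 B, 0 <= B & forall n x, wt x ^+ k * `|pderiv l (D n) x| <= B) ->
  (forall k e, 0 < e -> \forall n \near \oo, forall x, wt x ^+ k * `|D n x| <= e) ->
  sconv_real D (fun=> 0).
Proof.
move=> sD bD D0 l k e e0.
rewrite pderiv_cst0; under eq_near do under eq_forall do rewrite subr0.
elim: l k e e0 => [|i l IH] k e e0 /=; first exact: D0.
have [B B0 HB] := bD [:: i, i & l] k.
set K : R := 4 ^+ k; have K0 : 0 < K by rewrite exprn_gt0.
(* This [d] is at most 1 and satisfies [K * d * B <= e / 2]; the other half of [e] comes from asking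
   the induction hypothesis for [d * e / (4 * K)]. The summand [e] keeps the denominator positive
   even for [B = 0]. *)
pose d := e / (e + 2 * K * B).
have den0 : 0 < e + 2 * K * B by rewrite ltr_pwDl // !mulr_ge0 // ltW.
have d0 : 0 < d by rewrite divr_gt0.
have d1 : d <= 1 by rewrite ler_pdivrMr // mul1r lerDl !mulr_ge0 // ltW.
have e1 : 0 < d * e / (4 * K) by apply: divr_gt0; apply: mulr_gt0.
apply: filterS (IH k _ e1) => n Hn x.
apply: le_trans (@landau_interpolation _ i k _ B d _ _ Hn (HB n) _ x) _.
- by move=> z; exact: sD.
- by move=> z; exact: (sD n (i :: l)).
- by rewrite d0.
rewrite -/K mulrDr.
have -> : K * (2 * (d * e / (4 * K)) / d) = e / 2.
  by field; rewrite !gt_eqF.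
suff : K * (d * B) <= e / 2 by lra.
have -> : K * (d * B) = K * e * B / (e + 2 * K * B) by rewrite /d; ring.
rewrite ler_pdivrMr //.
have := ltW e0; have : 0 <= K * B by rewrite mulr_ge0 // ltW.
by nra.
Qed.

(** A move along one axis by at most [h] changes [u] by [h] times the derivative bound, and the
    weight by [4 ^+ k]. Four such moves lead from a lattice corner to any point of its cell. *)
Lemma wt_step u i k (A B h t : R) x : (forall z, derivable u z (Defs.basis R i)) ->
  (forall x, wt x ^+ k * `|'D_(Defs.basis R i) u x| <= B) ->
  0 <= t <= h -> h <= 1 -> wt x ^+ k * `|u x| <= A ->
  wt (x + t *: Defs.basis R i) ^+ k * `|u (x + t *: Defs.basis R i)|
    <= 4 ^+ k * (A + h * B).
Proof.
move=> du HB /andP[t0 th] h1 HA; have t1 := le_trans th h1.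
set b := Defs.basis R i; have [s /andP[s0 st] E] := mvt_basis x du t0.
have -> : u (x + t *: b) = u x + t * 'D_b u (x + s *: b) by rewrite -E addrCA subrr addr0.
have K0 : 0 <= 4 ^+ k :> R by rewrite exprn_ge0.
have w0 := ltW (wtX_gt0 (x + t *: b) k).
apply: le_trans (ler_wpM2l w0 (ler_normD _ _)) _.
rewrite mulrDr [X in _ <= X]mulrDr lerD //.
  apply: le_trans (_ : 4 ^+ k * wt x ^+ k * `|u x| <= _).
    rewrite ler_wpM2r //; have := @wt_shift i x 0 t k.
    by rewrite scale0r addr0; apply; rewrite ?lexx ?ler01 // t0.
  by rewrite -mulrA ler_wpM2l.
rewrite normrM (ger0_norm t0) mulrCA [X in _ <= X]mulrCA.
apply: ler_pM => //; first by rewrite mulr_ge0.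
apply: le_trans (_ : 4 ^+ k * wt (x + s *: b) ^+ k * `|'D_b u (x + s *: b)| <= _).
  by rewrite ler_wpM2r // wt_shift // ?s0 ?t0 //= (le_trans st).
by rewrite -mulrA ler_wpM2l.
Qed.

Lemma near_mesh (c e : R) : 0 <= c -> 0 < e -> \forall n \near \oo, c * mesh R n <= e.
Proof.
move=> c0 e0; have c1 : 0 < e / (c + 1) by rewrite divr_gt0 // ltr_wpDl.
have := @cvg_harmonic R; move/cvgrPdist_le => /(_ _ c1).
apply: filterS => n; rewrite sub0r normrN ger0_norm ?invr_ge0 // -/(mesh R n) => hn.
have m0 := ltW (mesh_gt0 R n).
apply: le_trans (_ : (c + 1) * mesh R n <= _); first by rewrite ler_wpM2r // lerDl.
by rewrite mulrC -ler_pdivlMr // ltr_wpDl.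
Qed.

(** The variable enters the sum only through its second factor, so all derivatives fall there. *)
Lemma pderiv_lsum n a b l : smooth b -> pderiv l (lsum n a b) = lsum n a (pderiv l b).
Proof.
move=> sb.
have E c : lsum n a c = fun z => \sum_(j <- box n)
    (mesh R n ^+ 4 * a (lat R n j)) * c (z - lat R n j).
  by apply/funext => z; apply: eq_bigr => j _; rewrite mulrA.
by rewrite !E pderiv_lincomb.
Qed.

Lemma smooth_lsum n a b : smooth b -> smooth (lsum n a b).
Proof.
move=> sb.
have -> : lsum n a b = fun z => \sum_(j <- box n)
    (mesh R n ^+ 4 * a (lat R n j)) * b (z - lat R n j).
  by apply/funext => z; apply: eq_bigr => j _; rewrite mulrA.
exact: smooth_lincomb.
Qed.

Definition rschwartz u := smooth u /\ rapid_decrease u.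

Definition cell n (t : R) : int := Num.floor (t / mesh R n).
Definition fl n (t : R) : R := lat1 R n (cell n t).

(** As an equality of booleans, this rewrites the indicator of a half-open mesh interval into a test
    on indices. *)
Lemma cellP n (t : R) j : (lat1 R n j <= t < lat1 R n j + mesh R n) = (j == cell n t).
Proof.
have h0 := mesh_gt0 R n; rewrite /lat1 /cell.
rewrite -ler_pdivlMr //.
have -> : j%:~R * mesh R n + mesh R n = (j + 1)%:~R * mesh R n.
  by rewrite rmorphD /= mulrDl mul1r.
rewrite -ltr_pdivrMr //.
apply/idP/eqP => [/floor_def -> //|->]; exact: floor_itv.
Qed.

Lemma fl_itv n (t : R) : fl n t <= t < fl n t + mesh R n.
Proof. by rewrite cellP. Qed.

Definition fl4 n (x : M) : M := ((fl n x.1.1, fl n x.1.2), (fl n x.2.1, fl n x.2.2)).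

(** The path from the corner to [x] runs along the axes because [smooth] provides derivatives in the
    basis directions only. *)
Lemma fl4_step n x : exists t : R * R * (R * R),
  [/\ 0 <= t.1.1 <= mesh R n, 0 <= t.1.2 <= mesh R n, 0 <= t.2.1 <= mesh R n,
      0 <= t.2.2 <= mesh R n &
  x = fl4 n x + t.1.1 *: Defs.basis R (@Ordinal 4 0 isT) +
   t.1.2 *: Defs.basis R (@Ordinal 4 1 isT) +
   t.2.1 *: Defs.basis R (@Ordinal 4 2 isT) +
   t.2.2 *: Defs.basis R (@Ordinal 4 3 isT)].
Proof.
have H t : 0 <= t - fl n t <= mesh R n.
  have /andP[h1 h2] := fl_itv n t.
  by rewrite subr_ge0 h1 lerBlDl ltW.
exists ((x.1.1 - fl n x.1.1, x.1.2 - fl n x.1.2), (x.2.1 - fl n x.2.1, x.2.2 - fl n x.2.2)).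
split; [exact: H..|].
have s1 (t : R) : t *: (1 : R) = t by exact: mulr1.
rewrite /Defs.basis /fl4 /=; case: x => -[x0 x1] [x2 x3] /=.
by congr ((_, _), (_, _)); rewrite /= !s1 !scaler0 !(addr0, add0r) addrC subrK.
Qed.

(** Its formal limit is the difference of the two convolutions of [a] and [b], which is 0 by
    commutativity. *)
Definition lcomm a b n x := lsum n a b x - lsum n b a x.

Lemma lcommE a b n : lcomm a b n = fun z => 1 * lsum n a b z + (-1) * lsum n b a z.
Proof. by apply/funext => z; rewrite mul1r mulN1r. Qed.

Lemma smooth_lcomm a b n : smooth a -> smooth b -> smooth (lcomm a b n).
Proof. by move=> sa sb; rewrite lcommE; apply: smooth_lin2; exact: smooth_lsum. Qed.

Lemma lcomm_bound a b : rschwartz a -> rschwartz b -> forall l k,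
  exists2 B, 0 <= B & forall n x, wt x ^+ k * `|pderiv l (lcomm a b n) x| <= B.
Proof.
move=> [sa ra] [sb rb] l k.
have [c c0 Hc] := lsum_bound (fast_decay_pderiv [::] ra) (fast_decay_pderiv l rb) k.
have [d d0 Hd] := lsum_bound (fast_decay_pderiv [::] rb) (fast_decay_pderiv l ra) k.
exists (c + d) => [|n x]; first exact: addr_ge0.
rewrite lcommE pderiv_lin2; [|exact: smooth_lsum..].
rewrite mul1r mulN1r !pderiv_lsum //.
apply: le_trans (ler_wpM2l _ (ler_normB _ _)) _; first by rewrite ltW // wtX_gt0.
by rewrite mulrDr lerD // ?Hc ?Hd.
Qed.

Lemma lcomm_small a b : rschwartz a -> rschwartz b -> forall k,
  exists2 c, 0 <= c & forall n x, wt x ^+ k * `|lcomm a b n x| <= c * mesh R n.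
Proof.
move=> sa sb k.
have [A A0 HA] := lsum_swap_small (fast_decay_pderiv [::] sa.2)
  (fast_decay_pderiv [::] sb.2) k.
have /boolp.choice[Bf HBf] : forall i, exists B, 0 <= B /\
    forall n x, wt x ^+ k * `|'D_(Defs.basis R i) (lcomm a b n) x| <= B.
  by move=> i; have [B B0 HB] := lcomm_bound sa sb [:: i] k; exists B; split.
pose B := \sum_i Bf i.
have B0 : 0 <= B by apply: sumr_ge0 => i _; have [] := HBf i.
have HB i n x : wt x ^+ k * `|'D_(Defs.basis R i) (lcomm a b n) x| <= B.
  have [_ H] := HBf i; apply: le_trans (H n x) _.
  rewrite /B (bigD1 i) //= lerDl; apply: sumr_ge0 => j _; by have [] := HBf j.
pose K : R := 4 ^+ k.
have K0 : 0 <= K by rewrite exprn_ge0.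
(* Four iterations, one per axis, of the map from [A] to [K * (A + B)] given by [wt_step], with
   [mesh R n] factored out. *)
exists (K * (K * (K * (K * (A + B) + B) + B) + B)) => [|n x].
  by do !(rewrite mulr_ge0 // ?addr_ge0 //).
have [t [t0 t1 t2 t3 xE]] := fl4_step n x.
have du i z : derivable (lcomm a b n) z (Defs.basis R i).
  by apply: (@smooth_lcomm a b n _ _ [::]); [exact: sa.1|exact: sb.1].
have m1 := mesh_le1 R n.
(* [fl4 n x] is the lattice point indexed by the cells of the coordinates of [x]; it may lie outside
   the box. *)
have Hy : wt (fl4 n x) ^+ k * `|lcomm a b n (fl4 n x)| <= A * mesh R n.
  exact: (HA n ((cell n x.1.1, cell n x.1.2), (cell n x.2.1, cell n x.2.2))).
have S0 := wt_step (du (@Ordinal 4 0 isT)) (HB _ n) t0 m1 Hy.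
have S1 := wt_step (du (@Ordinal 4 1 isT)) (HB _ n) t1 m1 S0.
have S2 := wt_step (du (@Ordinal 4 2 isT)) (HB _ n) t2 m1 S1.
have S3 := wt_step (du (@Ordinal 4 3 isT)) (HB _ n) t3 m1 S2.
rewrite [in leLHS]xE; apply: le_trans S3 _.
by rewrite le_eqVlt; apply/orP; left; apply/eqP; rewrite -/K; ring.
Qed.

Lemma lcomm_cvg a b : rschwartz a -> rschwartz b ->
  sconv_real (lcomm a b) (fun=> 0).
Proof.
move=> sa sb; apply: sconv_real0.
- by move=> n; apply: smooth_lcomm; [exact: sa.1|exact: sb.1].
- exact: lcomm_bound.
- move=> k e e0; have [c c0 Hc] := lcomm_small sa sb k.
  by apply: filterS (near_mesh c0 e0) => n hn x; apply: le_trans (Hc n x) _.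
Qed.

End PartialDerivatives.

(** * The Gaussian is a Schwartz function *)

Section Gaussian.
Variable R : realType.
Local Notation M := (Mn R).
Implicit Types (u p q : M -> R) (x v : M).

Lemma scaleRE (a b : R) : a *: b = a * b. Proof. by []. Qed.

(** Reduces a directional derivative to one variable, where derivatives of composite expressions are
    inferred automatically. *)
Lemma is_derive_line u x v d :
  is_derive (0 : R) 1 (fun t : R => u (x + t *: v)) d -> is_derive x v u d.
Proof.
move=> [ex val].
have E : (fun h : R => h^-1 *: (u (x + (h *: (1 : R) + 0) *: v) - u (x + (0 : R) *: v))) =
    (fun h : R => h^-1 *: (u (h *: v + x) - u x)).
  apply/funext => h; congr (_ *: (u _ - u _)); last by rewrite scale0r addr0.
  by rewrite [h *: 1]mulr1 addr0 addrC.
apply: DeriveDef; first by move: ex; rewrite /derivable /= E.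
by move: val; rewrite /derive /= E.
Qed.

Lemma coordD x v (t : R) i : Defs.coord (x + t *: v) i = Defs.coord x i + t * Defs.coord v i.
Proof. by rewrite /Defs.coord; case: i => -[|[|[|[|]]]]. Qed.

Lemma is_derive_coord x v i : is_derive x v (fun z => Defs.coord z i) (Defs.coord v i).
Proof.
apply: is_derive_line.
have -> : (fun t : R => Defs.coord (x + t *: v) i) = (fun t : R => Defs.coord x i + t * Defs.coord v i).
  by apply/funext => t; rewrite coordD.
by apply: is_derive_eq; rewrite !scaleRE; ring.
Qed.

Lemma eucl2_coord x : eucl2 x = \sum_i Defs.coord x i ^+ 2.
Proof. by rewrite !big_ord_recl big_ord0 /eucl2 /Defs.coord /= addr0 !addrA. Qed.

Definition gauss4 x : R := expR (- eucl2 x).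

Lemma is_derive_gauss4 x v :
  is_derive x v gauss4 (- (2 * \sum_i Defs.coord x i * Defs.coord v i) * gauss4 x).
Proof.
apply: is_derive_line.
pose c := \sum_i Defs.coord x i * Defs.coord v i.
have E t : gauss4 (x + t *: v) = expR (- (eucl2 x + (2 * c) * t + eucl2 v * t ^+ 2)).
  congr (expR (- _)); rewrite !eucl2_coord /c mulr_sumr !mulr_suml -!big_split /=.
  by apply: eq_bigr => i _; rewrite coordD; ring.
under [X in is_derive _ _ X]funext do rewrite E.
apply: is_derive_eq.
rewrite /gauss4 -/c.
by rewrite !scaleRE !(mulr0, expr0n, addr0) /=; ring.
Qed.

(** Polynomial functions, generated inductively so that closure under derivation and polynomial
    growth follow by induction. Every derivative of the Gaussian is such a function times the
    Gaussian. *)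
Inductive polyf : (M -> R) -> Prop :=
| polyf_cst c : polyf (fun=> c)
| polyf_coord i : polyf (fun x => Defs.coord x i)
| polyf_add p q : polyf p -> polyf q -> polyf (fun x => p x + q x)
| polyf_mul p q : polyf p -> polyf q -> polyf (fun x => p x * q x).

Lemma polyf_derive p v : polyf p ->
  exists2 q, polyf q & forall x, is_derive x v p (q x).
Proof.
elim=> [c|i|{}p q hp [p' hp' dp] hq [q' hq' dq]|{}p q hp [p' hp' dp] hq [q' hq' dq]].
- by exists (fun=> 0); [exact: polyf_cst|move=> x; exact: is_derive_cst].
- exists (fun=> Defs.coord v i); first exact: polyf_cst.
  by move=> x; exact: is_derive_coord.
- exists (fun x => p' x + q' x); first exact: polyf_add.
  by move=> x; exact: is_deriveD.
- exists (fun x => p x * q' x + q x * p' x).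
    by apply: polyf_add; apply: polyf_mul.
  by move=> x; exact: is_deriveM.
Qed.

Lemma polyf_bound p : polyf p ->
  exists c m, 0 <= c /\ forall x, `|p x| <= c * wt x ^+ m.
Proof.
elim=> [c|i|{}p q _ [c [m [c0 hc]]] _ [d [k [d0 hd]]]|
    {}p q _ [c [m [c0 hc]]] _ [d [k [d0 hd]]]].
- by exists `|c|, 0%N; split=> // x; rewrite expr0 mulr1.
- exists 1, 1%N; split=> // x; rewrite mul1r expr1.
  have h : Defs.coord x i ^+ 2 <= eucl2 x.
    by rewrite eucl2_coord (bigD1 i) //= lerDl sumr_ge0 // => j _; rewrite sqr_ge0.
  rewrite /wt; have := sqr_ge0 (`|Defs.coord x i| - 1); rewrite -[Defs.coord x i ^+ 2]real_normK ?num_real // in h *.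
  by have := normr_ge0 (Defs.coord x i); nra.
- exists (c + d), (m + k)%N; split; first exact: addr_ge0.
  move=> x; apply: le_trans (ler_normD _ _) _; rewrite mulrDl lerD //.
    apply: le_trans (hc x) _; rewrite ler_wpM2l // exprD ler_peMr ?wtX_ge1 //.
    by rewrite ltW // wtX_gt0.
  apply: le_trans (hd x) _; rewrite ler_wpM2l // exprD ler_peMl ?wtX_ge1 //.
  by rewrite ltW // wtX_gt0.
- exists (c * d), (m + k)%N; split; first exact: mulr_ge0.
  move=> x; rewrite normrM exprD mulrACA; exact: ler_pM.
Qed.

Lemma pderiv_gauss4 l : exists2 p, polyf p & pderiv l gauss4 = fun x => p x * gauss4 x.
Proof.
elim: l => [|i l [p hp IH]] /=.
  exists (fun=> 1); first exact: polyf_cst.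
  by apply/funext => x; rewrite mul1r.
have [p' hp' dp] := polyf_derive (Defs.basis R i) hp.
exists (fun x => p x * (- 2 * Defs.coord x i) + p' x).
  by apply: polyf_add => //; apply: polyf_mul => //; apply: polyf_mul;
    [exact: polyf_cst|exact: polyf_coord].
apply/funext => x; rewrite IH.
have dg := is_derive_gauss4 x (Defs.basis R i).
have H := dp x.
have D : is_derive x (Defs.basis R i) (fun x => p x * gauss4 x)
  (p x * (- (2 * \sum_j Defs.coord x j * Defs.coord (Defs.basis R i) j) * gauss4 x) +
   gauss4 x * p' x) by exact: is_deriveM.
rewrite (@derive_val _ _ _ _ _ _ _ D).
have -> : \sum_j Defs.coord x j * Defs.coord (Defs.basis R i) j = Defs.coord x i.
  rewrite !big_ord_recl big_ord0 /Defs.coord /Defs.basis /=.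
  by case: i {dp dg H D} => -[|[|[|[|]]]] //= _; rewrite !(mulr0, mulr1, addr0, add0r).
by ring.
Qed.

Lemma rschwartz_gauss4 : rschwartz gauss4.
Proof.
split=> [l i x|l k].
  have [p hp ->] := pderiv_gauss4 l.
  have [p' _ dp] := polyf_derive (Defs.basis R i) hp.
  have dg := is_derive_gauss4 x (Defs.basis R i).
  by apply: derivableM; apply: ex_derive.
have [p hp ->] := pderiv_gauss4 l.
have [c [m [c0 hc]]] := polyf_bound hp.
(* With [N = (k + m).+1], the exponential series gives [wt x ^+ N <= N! * expR (wt x)]; moreover
   [expR (wt x) * gauss4 x = expR 1] because [wt x = 1 + eucl2 x]. *)
exists (c * ((k + m).+1`!%:R * expR 1)) => x; rewrite -/(wt x).
have g0 : 0 <= gauss4 x by exact: expR_ge0.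
apply: le_trans (_ : c * (wt x ^+ (k + m).+1 * gauss4 x) <= _).
  rewrite normrM (ger0_norm g0) mulrA [X in _ <= X]mulrA ler_wpM2r //.
  rewrite -addnS exprD mulrCA ler_wpM2l ?(ltW (wtX_gt0 _ _)) //.
  apply: le_trans (hc x) _; rewrite ler_wpM2l // exprS ler_peMl ?wt_ge1 //.
  by rewrite ltW // wtX_gt0.
rewrite ler_wpM2l //.
have f0 : 0 < (k + m).+1`!%:R :> R by rewrite ltr0n fact_gt0.
have := expR_ge1Dxn (k + m) (ltW (wt_gt0 x)).
move=> h; have {}h : wt x ^+ (k + m).+1 <= (k + m).+1`!%:R * expR (wt x).
  by rewrite mulrC -ler_pdivrMr //; apply: le_trans h; rewrite lerDr.
apply: le_trans (ler_wpM2r g0 h) _.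
rewrite -mulrA ler_wpM2l ?(ltW f0) //.
by rewrite /gauss4 -expRD /wt addrK.
Qed.

End Gaussian.

(** * Real and imaginary parts *)

Section ComplexParts.
Variable R : realType.

Lemma cReD (a b : Cx R) : cRe (a + b) = cRe a + cRe b.
Proof. by case: a => a1 a2; case: b. Qed.

Lemma cImD (a b : Cx R) : cIm (a + b) = cIm a + cIm b.
Proof. by case: a => a1 a2; case: b. Qed.

Lemma cRe_sum (T : Type) (s : seq T) (F : T -> Cx R) :
  cRe (\sum_(j <- s) F j) = \sum_(j <- s) cRe (F j).
Proof. by elim/big_rec2: _ => [//|j a b _ <-]; rewrite cReD. Qed.

Lemma cIm_sum (T : Type) (s : seq T) (F : T -> Cx R) :
  cIm (\sum_(j <- s) F j) = \sum_(j <- s) cIm (F j).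
Proof. by elim/big_rec2: _ => [//|j a b _ <-]; rewrite cImD. Qed.

Lemma cReM (a b : Cx R) : cRe (a * b) = cRe a * cRe b - cIm a * cIm b.
Proof. by case: a => a1 a2; case: b. Qed.

Lemma cImM (a b : Cx R) : cIm (a * b) = cRe a * cIm b + cIm a * cRe b.
Proof. by case: a => a1 a2; case: b => b1 b2. Qed.

Lemma cReN (z : Cx R) : cRe (- z) = - cRe z. Proof. by case: z. Qed.
Lemma cImN (z : Cx R) : cIm (- z) = - cIm z. Proof. by case: z. Qed.

Lemma cabs2_ge0 (z : Cx R) : 0 <= cabs2 z.
Proof. by rewrite /cabs2 addr_ge0 ?sqr_ge0. Qed.

Lemma cabs2M (a b : Cx R) : cabs2 (a * b) = cabs2 a * cabs2 b.
Proof. by rewrite /cabs2 cReM cImM; ring. Qed.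

Lemma cabs2B (a b : Cx R) : cabs2 (a - b) <= 2 * cabs2 a + 2 * cabs2 b.
Proof.
rewrite /cabs2 cReD cImD cReN cImN; move: (cRe _) (cIm _) (cRe _) (cIm _) => x y z t.
by have := sqr_ge0 (x + z); have := sqr_ge0 (y + t); nra.
Qed.

End ComplexParts.

(** * Convergence of Riemann sums to integrals and to the Fourier transform *)

Section RiemannSums.
Variable R : realType.
Local Notation M := (Mn R).
Local Notation leb := (@lebesgue_measure R).

Lemma fl_dist n (t : R) : `|t - fl n t| <= mesh R n.
Proof.
have /andP[h1 h2] := fl_itv n t.
by rewrite ger0_norm ?subr_ge0 // lerBlDl ltW.
Qed.

Lemma cvg_mesh (u : nat -> R) (l c : R) : (forall n, `|l - u n| <= c * mesh R n) ->
  u n @[n --> \oo] --> l.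
Proof.
move=> H; apply/cvgrPdist_le => e e0.
have c0 : 0 <= c.
  by have := le_trans (normr_ge0 _) (H 0%N); rewrite pmulr_lge0 // mesh_gt0.
by apply: filterS (near_mesh c0 e0) => n; apply: le_trans.
Qed.

Lemma fl_cvg (t : R) : fl n t @[n --> \oo] --> t.
Proof. by apply: (@cvg_mesh _ _ 1) => n; rewrite mul1r fl_dist. Qed.

(** The lattice reaches out to [n + 1] and rounding moves [t] by at most 1, so [|t| + 1 <= n + 1] is
    enough. *)
Lemma cell_line (t : R) : \forall n \near \oo, cell n t \in line n.
Proof.
near=> n.
have hn : `|t| + 1 <= n.+1%:R.
  near: n; have := @nbhs_infty_ger R (`|t| + 1).
  by apply: filterS => n h; apply: le_trans h _; rewrite ler_nat.
rewrite mem_line -(ler_int R) intr_norm.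
have h0 := mesh_gt0 R n; have h1 := mesh_le1 R n.
have nE : n.+1%:R * mesh R n = 1 by rewrite /mesh divff // pnatr_eq0.
have d := fl_dist n t.
have h : `|fl n t| <= n.+1%:R.
  apply: le_trans hn; have -> : fl n t = t - (t - fl n t) by rewrite subKr.
  by apply: le_trans (ler_normB _ _) _; rewrite lerD2l (le_trans d).
have {h} : `|(cell n t)%:~R : R| * mesh R n <= n.+1%:R.
  by rewrite -[X in _ * X](gtr0_norm h0) -normrM.
rewrite -ler_pdivlMr // /mesh invrK => h; apply: le_trans h _.
by rewrite -natrM.
Unshelve. all: end_near. Qed.

(** Its integral over the whole line is the Riemann sum [rsum1 n U], which turns convergence of
    Riemann sums into dominated convergence. *)
Definition step n (U : R -> R) (t : R) : R :=
  \sum_(j <- line n) U (lat1 R n j) * \1_(`[lat1 R n j, lat1 R n j + mesh R n[%classic) t.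

Lemma stepE n U t : step n U t = if cell n t \in line n then U (fl n t) else 0.
Proof.
have iE j : (\1_(`[lat1 R n j, lat1 R n j + mesh R n[%classic) t : R) = (j == cell n t)%:R.
  by rewrite indicE mem_setE in_itv /= cellP.
rewrite /step; under eq_bigr do rewrite iE.
case: ifPn => cl.
  rewrite (bigD1_seq (cell n t)) ?line_uniq //= eqxx mulr1 big1 ?addr0 // => j.
  by move=> /negPf ->; rewrite mulr0.
rewrite big1_seq // => j /= jl; case: eqP => [E|]; last by rewrite mulr0.
by move: cl; rewrite -E jl.
Qed.

Definition rsum1 n (U : R -> R) : R := \sum_(j <- line n) mesh R n * U (lat1 R n j).

Lemma integrable_step_term n j (c : R) : leb.-integrable setT
  (fun t => (c * \1_(`[lat1 R n j, lat1 R n j + mesh R n[%classic) t)%:E).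
Proof.
under eq_fun do rewrite EFinM.
apply: integrableZl => //.
by apply: (@integrable_indic_itv R _ _ true true).
Qed.

Lemma measurable_step n U : measurable_fun setT (step n U).
Proof.
apply: measurable_sum => j; apply/measurable_EFinP.
exact: measurable_int (integrable_step_term _ _ _).
Qed.

Lemma integral_step n U : (\int[leb]_t (step n U t)%:E)%E = (rsum1 n U)%:E.
Proof.
rewrite /step; under eq_integral do rewrite -sumEFin.
rewrite integral_sum //; last by move=> j; exact: integrable_step_term.
rewrite /rsum1 -sumEFin; apply: eq_bigr => j _.
under eq_integral do rewrite EFinM.
rewrite integralZl //; last exact: (@integrable_indic_itv R _ _ true true).
rewrite integral_indic //= setIT lebesgue_measure_itv /= lte_fin ltrDl mesh_gt0.
by rewrite EFinN -EFinD addrAC subrr add0r -EFinM mulrC.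
Qed.

Lemma integrable_oneDsqr (c : R) : leb.-integrable setT (fun t : R => (c / (1 + t ^+ 2))%:E).
Proof.
under eq_fun do rewrite EFinM.
apply: integrableZl => //.
have cf := @continuous_oneDsqrV R.
have mf : measurable_fun [set: R] (fun t : R => (1 + t ^+ 2)^-1).
  exact: continuous_measurable_fun cf.
apply/integrableP; split; first exact/measurable_EFinP.
have -> : (\int[leb]_t `|((1 + t ^+ 2)^-1)%:E| = \int[leb]_t ((1 + t ^+ 2)^-1)%:E)%E.
  by apply: eq_integral => t _; rewrite gee0_abs // lee_fin invr_ge0 ltW // oneDsq_gt0.
rewrite ge0_symfun_integralT //.
- rewrite (_ : [set x | _] = `[0, +oo[%classic); last first.
    by apply/seteqP; split => x/=; rewrite in_itv/= andbT.
  by rewrite (@integral0y_oneDsqr R) ltry.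
- by move=> x; rewrite invr_ge0 ltW // oneDsq_gt0.
- by move=> x; rewrite /= sqrrN.
Qed.

(** The integrand may vary with [n] because in four dimensions it is itself a Riemann sum over the
    remaining coordinates. *)
Lemma riem1 (U_ : nat -> R -> R) (U : R -> R) (c : R) :
  (forall n t, `|U_ n t| <= c / (1 + t ^+ 2)) ->
  (forall t, U_ n (fl n t) @[n --> \oo] --> U t) ->
  rsum1 n (U_ n) @[n --> \oo] --> Rintegral leb setT U.
Proof.
move=> HU cU.
have c0 : 0 <= c.
  by have := le_trans (normr_ge0 _) (HU 0%N 0); rewrite expr0n addr0 divr1.
have sc t : step n (U_ n) t @[n --> \oo] --> U t.
  apply: cvg_trans (cU t); apply: near_eq_cvg.
  by apply: filterS (cell_line t) => n cl; rewrite stepE cl.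
(* The factor 3 pays for the majorant being taken at [fl n t] instead of [t]: they differ by at most
   1, whence [1 + t^2 <= 3 (1 + (fl n t)^2)]. *)
have bd n t : `|step n (U_ n) t| <= 3 * c / (1 + t ^+ 2).
  have p0 := oneDsq_gt0 t; have q0 := oneDsq_gt0 (fl n t).
  rewrite stepE; case: ifP => _; last first.
    by rewrite normr0 divr_ge0 ?(ltW p0) // mulr_ge0.
  apply: le_trans (HU _ _) _.
  rewrite ler_pdivrMr // mulrAC ler_pdivlMr //.
  have := le_trans (fl_dist n t) (mesh_le1 R n); rewrite ler_norml => /andP[h1 h2].
  suff : 1 + t ^+ 2 <= 3 * (1 + fl n t ^+ 2).
    by move=> h; rewrite [3 * c]mulrC -mulrA ler_wpM2l.
  have : (t - fl n t) ^+ 2 <= 1 by nra.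
  have := sqr_ge0 (t - 2 * fl n t); nra.
have ig := integrable_oneDsqr (3 * c).
have iU : leb.-integrable setT (EFin \o U).
  apply: (le_integrable measurableT _ _ ig).
    apply/measurable_EFinP; apply: (measurable_fun_cvg (h := fun n => step n (U_ n))).
      by move=> n; exact: measurable_step.
    by move=> t _; exact: sc.
  move=> t _; rewrite /= lee_fin [X in _ <= X]ger0_norm; last first.
    by rewrite divr_ge0 ?mulr_ge0 // ltW // oneDsq_gt0.
  have sn : `|step n (U_ n) t| @[n --> \oo] --> `|U t| by apply: cvg_norm; exact: sc.
  by apply: (cvgr_to_le sn); apply: nearW => n; exact: bd.
have H : (\int[leb]_t (step n (U_ n) t)%:E)%E @[n --> \oo] --> (Rintegral leb setT U)%:E.
  rewrite fineK; last exact: integrable_fin_num.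
  apply: (dominated_cvg measurableT _ _ _ ig).
  - by move=> n; apply/measurable_EFinP; exact: measurable_step.
  - by move=> t _; apply: cvg_EFin; [exact: nearW|exact: sc].
  - by [].
  - by move=> n t _; rewrite lee_fin bd.
move/fine_cvg : H; apply: cvg_trans; apply: near_eq_cvg; apply: nearW => n /=.
by rewrite integral_step.
Qed.

Lemma rsum1_bound n U (c : R) : (forall t, `|U t| <= c / (1 + t ^+ 2)) ->
  `|rsum1 n U| <= 8 * c.
Proof.
move=> HU.
have c0 : 0 <= c.
  by have := le_trans (normr_ge0 _) (HU 0); rewrite expr0n addr0 divr1.
apply: le_trans (ler_norm_sum _ _ _) _.
apply: le_trans (_ : \sum_(j <- line n) c * (mesh R n / (1 + lat1 R n j ^+ 2)) <= _).
  apply: ler_sum => j _; rewrite normrM (gtr0_norm (mesh_gt0 _ _)) mulrCA.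
  by rewrite ler_wpM2l // ltW // mesh_gt0.
by rewrite -mulr_sumr mulrC ler_wpM2r // sum_line_oneDsq.
Qed.

Definition rsum4 n (u : M -> R) : R := \sum_(j <- box n) mesh R n ^+ 4 * u (lat R n j).

Lemma rsum4E n u : rsum4 n u = rsum1 n (fun a => rsum1 n (fun b =>
  rsum1 n (fun c => rsum1 n (fun d => u ((a, b), (c, d)))))).
Proof.
rewrite /rsum4 /rsum1 sum_box.
apply: eq_bigr => a _; rewrite mulr_sumr; apply: eq_bigr => b _.
rewrite !mulr_sumr; apply: eq_bigr => c _; rewrite !mulr_sumr; apply: eq_bigr => d _.
by rewrite /lat /=; ring.
Qed.

(** [int4] is an iterated integral, so [riem1] is applied four times from the outside in. In the
    inner applications the outer variables are the moving points [fl n x0] and so on; bounding their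
    decay factors by 1 ([drop]) makes the majorant independent of [n]. *)
Lemma riem4 (u : M -> R) (c : R) : (forall x, `|u x| <= c / prod4 x) ->
  (forall x, u (fl4 n x) @[n --> \oo] --> u x) ->
  rsum4 n u @[n --> \oo] --> int4 u.
Proof.
move=> Hu cu.
have q0 (t : R) := oneDsq_gt0 t.
have c0 : 0 <= c.
  have := le_trans (normr_ge0 _) (Hu 0); rewrite /prod4 /= !expr0n /= !addr0.
  by rewrite !mulr1 divr1.
have b3 x0 x1 x2 t : `|u ((x0, x1), (x2, t))| <=
    c / (1 + x0 ^+ 2) / (1 + x1 ^+ 2) / (1 + x2 ^+ 2) / (1 + t ^+ 2).
  apply: le_trans (Hu _) _; rewrite le_eqVlt; apply/orP; left; apply/eqP.
  by rewrite /prod4 /=; field; rewrite !gt_eqF.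
have b2 n x0 x1 t : `|rsum1 n (fun d => u ((x0, x1), (t, d)))| <=
    8 * c / (1 + x0 ^+ 2) / (1 + x1 ^+ 2) / (1 + t ^+ 2).
  by apply: le_trans (rsum1_bound _ (b3 _ _ _)) _; rewrite !mulrA.
have b1 n x0 t : `|rsum1 n (fun c => rsum1 n (fun d => u ((x0, t), (c, d))))| <=
    8 * (8 * c) / (1 + x0 ^+ 2) / (1 + t ^+ 2).
  by apply: le_trans (rsum1_bound _ (b2 _ _ _)) _; rewrite !mulrA.
have b0 n t : `|rsum1 n (fun b => rsum1 n (fun c => rsum1 n (fun d => u ((t, b), (c, d)))))|
    <= 8 * (8 * (8 * c)) / (1 + t ^+ 2).
  by apply: le_trans (rsum1_bound _ (b1 _ _)) _; rewrite !mulrA.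
under eq_fun do rewrite rsum4E.
have drop (e s : R) : 0 <= e -> e / (1 + s ^+ 2) <= e.
  by move=> e0; rewrite ler_pdivrMr // ler_peMr // lerDl sqr_ge0.
have div (e s : R) : 0 <= e -> 0 <= e / (1 + s ^+ 2).
  by move=> e0; rewrite divr_ge0 // ltW.
have mono (e f s : R) : e <= f -> e / (1 + s ^+ 2) <= f / (1 + s ^+ 2).
  by move=> ef; rewrite ler_wpM2r // invr_ge0 ltW.
apply: (riem1 b0) => x0.
apply: (@riem1 _ _ (8 * (8 * c))) => [n t|x1].
  apply: le_trans (b1 _ _ _) _; apply: mono; apply: drop; by rewrite !mulr_ge0.
apply: (@riem1 _ _ (8 * c)) => [n t|x2].
  apply: le_trans (b2 _ _ _ _) _; apply: mono; apply: le_trans (drop _ _ _) (drop _ _ _).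
  - by apply: div; rewrite mulr_ge0.
  - by rewrite mulr_ge0.
apply: (@riem1 _ _ c) => [n t|x3].
  apply: le_trans (b3 _ _ _ _) _; apply: mono.
  apply: le_trans (drop _ _ _) _; first by apply/div/div.
  by apply: le_trans (drop _ _ _) (drop _ _ _) => //; apply: div.
exact: (cu ((x0, x1), (x2, x3))).
Qed.

(** Joint continuity is not part of [smooth]; bounded partial derivatives along the axis-parallel
    path from the corner give the convergence directly. *)
Lemma rschwartz_fl4 (u : M -> R) : rschwartz u ->
  forall x, u (fl4 n x) @[n --> \oo] --> u x.
Proof.
move=> [su ru] x.
have H i : exists B, 0 <= B /\ forall z, `|'D_(Defs.basis R i) u z| <= B.
  have [B B0 HB] := fast_decay_pderiv [:: i] ru 0%N.
  by exists B; split => // z; have := HB z; rewrite expr0 mul1r.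
have [B0 [B0p H0]] := H (@Ordinal 4 0 isT); have [B1 [B1p H1]] := H (@Ordinal 4 1 isT).
have [B2 [B2p H2]] := H (@Ordinal 4 2 isT); have [B3 [B3p H3]] := H (@Ordinal 4 3 isT).
have S i B (t : R) n z : 0 <= B -> (forall z, `|'D_(Defs.basis R i) u z| <= B) ->
    0 <= t <= mesh R n -> `|u (z + t *: Defs.basis R i) - u z| <= B * mesh R n.
  move=> B_0 HB /andP[t0 tm].
  have [s _ ->] := mvt_basis z (su [::] i) t0.
  by rewrite normrM (ger0_norm t0) mulrC ler_pM.
apply: (@cvg_mesh _ _ (B3 + B2 + B1 + B0)) => n.
have [t [t0 t1 t2 t3 xE]] := fl4_step n x.
set y := fl4 n x.
pose z0 := y + t.1.1 *: Defs.basis R (@Ordinal 4 0 isT).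
pose z1 := z0 + t.1.2 *: Defs.basis R (@Ordinal 4 1 isT).
pose z2 := z1 + t.2.1 *: Defs.basis R (@Ordinal 4 2 isT).
pose z3 := z2 + t.2.2 *: Defs.basis R (@Ordinal 4 3 isT).
have -> : u x = u z3 by congr u.
have -> : u z3 - u y = (u z3 - u z2) + (u z2 - u z1) + (u z1 - u z0) + (u z0 - u y) by ring.
have := S _ _ _ n z2 B3p H3 t3; have := S _ _ _ n z1 B2p H2 t2.
have := S _ _ _ n z0 B1p H1 t1; have := S _ _ _ n y B0p H0 t0.
rewrite -/z0 -/z1 -/z2 -/z3 !mulrDl => a0 a1 a2 a3.
by do 3 (apply: le_trans (ler_normD _ _) (lerD _ _) => //).
Qed.

Lemma lorentz_fl4 (p x : M) : lorentz p (fl4 n x) @[n --> \oo] --> lorentz p x.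
Proof.
have H (c t : R) : c * fl n t @[n --> \oo] --> c * t.
  by apply: cvgM; [exact: cvg_cst|exact: fl_cvg].
by apply: cvgD; [apply: cvgD; [apply: cvgD; [apply: cvgN|]|]|]; exact: H.
Qed.

Lemma norm_cos_le1 (t : R) : `|cos t| <= 1.
Proof. by rewrite ler_norml cos_geN1 cos_le1. Qed.

Lemma norm_sin_le1 (t : R) : `|sin t| <= 1.
Proof. by rewrite ler_norml sin_geN1 sin_le1. Qed.

Lemma trig_bound (a b t : R) :
  `|cos t * a - sin t * b| <= `|a| + `|b| /\ `|cos t * b + sin t * a| <= `|a| + `|b|.
Proof.
have H (s c : R) : `|s| <= 1 -> `|s * c| <= `|c|.
  by move=> s1; rewrite normrM ler_piMl.
split.
  by apply: le_trans (ler_normB _ _) (lerD _ _); apply: H; rewrite ?norm_cos_le1 ?norm_sin_le1.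
rewrite [X in _ <= X]addrC.
by apply: le_trans (ler_normD _ _) (lerD _ _); apply: H; rewrite ?norm_cos_le1 ?norm_sin_le1.
Qed.

(** This is the multiplier of a lattice combination of translates weighted by samples of [f], since
    translation by [a] multiplies by [expi (lorentz a p)]. It is also a Riemann sum of
    [fourier f p]. *)
Definition fourier_sum n (f : M -> Cx R) (p : M) : Cx R :=
  \sum_(j <- box n) cmk (mesh R n ^+ 4) 0 * f (lat R n j) * expi (lorentz (lat R n j) p).

Lemma lorentzC (x y : M) : lorentz x y = lorentz y x.
Proof. by rewrite /lorentz; ring. Qed.

Lemma fourier_sumE n f p : fourier_sum n f p =
  cmk (rsum4 n (fun x => cRe (expi (lorentz p x) * f x)))
      (rsum4 n (fun x => cIm (expi (lorentz p x) * f x))).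
Proof.
have cE (z : Cx R) : z = cmk (cRe z) (cIm z) by case: z.
rewrite [LHS]cE cRe_sum cIm_sum; congr cmk; apply: eq_bigr => j _.
  by rewrite lorentzC !cReM !cImM /=; ring.
by rewrite lorentzC !cImM cReM /=; ring.
Qed.

Lemma fast_decay_fourier (f : M -> Cx R) : schwartz f -> exists2 c, 0 <= c &
  forall p x, `|cRe (expi (lorentz p x) * f x)| <= c / prod4 x /\
              `|cIm (expi (lorentz p x) * f x)| <= c / prod4 x.
Proof.
move=> [_ [_ [rf if_]]].
have [a a0 Ha] := fast_decay_prod4 (fast_decay_pderiv [::] rf).
have [b b0 Hb] := fast_decay_prod4 (fast_decay_pderiv [::] if_).
exists (a + b) => [|p x]; first exact: addr_ge0.
have [h1 h2] := trig_bound (cRe (f x)) (cIm (f x)) (lorentz p x).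
have h3 := lerD (Ha x) (Hb x); rewrite -mulrDl in h3.
by rewrite cReM cImM; split; [apply: le_trans h1 h3|apply: le_trans h2 h3].
Qed.

Lemma fourier_sum_cvg (f : M -> Cx R) p : schwartz f ->
  ccvg (fun n => fourier_sum n f p) (fourier f p).
Proof.
move=> sf; have [c c0 H] := fast_decay_fourier sf.
have [s1 [s2 [r1 r2]]] := sf.
have cR := rschwartz_fl4 (conj s1 r1); have cI := rschwartz_fl4 (conj s2 r2).
have cc x : cos (lorentz p (fl4 n x)) @[n --> \oo] --> cos (lorentz p x).
  apply: (@cvg_comp _ _ _ (fun n => lorentz p (fl4 n x)) cos _ (nbhs (lorentz p x))).
    exact: lorentz_fl4.
  exact: continuous_cos.
have cs x : sin (lorentz p (fl4 n x)) @[n --> \oo] --> sin (lorentz p x).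
  apply: (@cvg_comp _ _ _ (fun n => lorentz p (fl4 n x)) sin _ (nbhs (lorentz p x))).
    exact: lorentz_fl4.
  exact: continuous_sin.
split.
  rewrite /=; under eq_fun do rewrite fourier_sumE /=.
  apply: (riem4 (c := c)) => x; first by have [] := H p x.
  rewrite cReM; under eq_fun do rewrite cReM.
  by apply: cvgB; apply: cvgM => //=; [exact: cR|exact: cI].
rewrite /=; under eq_fun do rewrite fourier_sumE /=.
apply: (riem4 (c := c)) => x; first by have [] := H p x.
rewrite cImM; under eq_fun do rewrite cImM.
by apply: cvgD; apply: cvgM => //=; [exact: cI|exact: cR].
Qed.

Lemma rsum4_bound n (u : M -> R) (c : R) : (forall x, `|u x| <= c / prod4 x) ->
  `|rsum4 n u| <= 8 ^+ 4 * c.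
Proof.
move=> Hu.
have c0 : 0 <= c.
  have := le_trans (normr_ge0 _) (Hu 0); rewrite /prod4 /= !expr0n /= !addr0.
  by rewrite !mulr1 divr1.
have m0 : 0 <= mesh R n ^+ 4 by rewrite exprn_ge0 // ltW // mesh_gt0.
apply: le_trans (ler_norm_sum _ _ _) _.
apply: le_trans (_ : \sum_(j <- box n) c * (mesh R n ^+ 4 / prod4 (lat R n j)) <= _).
  by apply: ler_sum => j _; rewrite normrM (ger0_norm m0) mulrCA ler_wpM2l.
by rewrite -mulr_sumr mulrC ler_wpM2r // sum_box_prod4.
Qed.

(** Uniformity in both the mesh and [p] is what dominated convergence under [mu] requires; it holds
    because the phase has modulus 1. *)
Lemma fourier_sum_bound (f : M -> Cx R) : schwartz f -> exists2 c, 0 <= c &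
  forall n p, `|cRe (fourier_sum n f p)| <= c /\ `|cIm (fourier_sum n f p)| <= c.
Proof.
move=> sf; have [c c0 H] := fast_decay_fourier sf.
exists (8 ^+ 4 * c) => [|n p]; first by rewrite mulr_ge0 ?exprn_ge0.
by rewrite fourier_sumE /=; split; apply: rsum4_bound => x; have [] := H p x.
Qed.

End RiemannSums.

(** * The Fourier transform of the Gaussian *)

Section GaussianFourier.
Variable R : realType.
Local Notation M := (Mn R).
Local Notation leb := (@lebesgue_measure R).

(** Fundamental theorem of calculus between [- (n + 1)] and [n + 1]: the boundary values are of
    order [mesh R n], and dominated convergence passes to the whole line. *)
Lemma Rintegral_derive0 (h h' : R -> R) (c : R) :
  (forall t : R, is_derive t 1 h (h' t)) -> continuous h' ->
  leb.-integrable setT (EFin \o h') -> (forall t, `|h t| <= c / (1 + t ^+ 2)) ->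
  Rintegral leb setT h' = 0.
Proof.
move=> dh ch ih bh.
have c0 : 0 <= c by have := le_trans (normr_ge0 _) (bh 0); rewrite expr0n addr0 divr1.
pose I (n : nat) : set R := `[- n.+1%:R, n.+1%:R]%classic.
have mI n : measurable (I n) by exact: measurable_itv.
have E n : (\int[leb]_(t in I n) (h' t)%:E = (h n.+1%:R - h (- n.+1%:R))%:E)%E.
  rewrite (@continuous_FTC2 _ h' h) //.
  - by rewrite -subr_gt0 opprK addr_gt0.
  - by apply: continuous_subspaceT.
  - have ch0 t : {for t, continuous h}.
      by apply: differentiable_continuous; apply/derivable1_diffP.
    split; [by move=> t _; apply: ex_derive| |].
      by apply: cvg_at_right_filter; exact: ch0.
    by apply: cvg_at_left_filter; exact: ch0.
  - by move=> t _; rewrite derive1E; apply: derive_val.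
have lim0 : (h n.+1%:R - h (- n.+1%:R)) @[n --> \oo] --> (0 : R).
  apply: (@cvg_mesh _ _ _ (2 * c)) => n; rewrite sub0r normrN.
  have H (s : R) : s ^+ 2 = n.+1%:R ^+ 2 -> `|h s| <= c * mesh R n.
    move=> s2; apply: le_trans (bh _) _; rewrite s2 ler_wpM2l //.
    rewrite /mesh lef_pV2 ?posrE ?oneDsq_gt0 ?ltr0n //.
    have := ler1n R n.+1; set x : R := n.+1%:R => /=.
    by rewrite -/x => h1; have : 1 <= x by []; nra.
  apply: le_trans (ler_normB _ _) _.
  rewrite -mulrA [2 * _]mulr_natl mulr2n lerD //; apply: H => //.
  by rewrite sqrrN.
have limI : (\int[leb]_t ((h' \_ (I n)) t)%:E)%E @[n --> \oo] --> (\int[leb]_t (h' t)%:E)%E.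
  have iah : leb.-integrable setT (fun t => `|(h' t)%:E|%E) by exact: integrable_abse.
  apply: (dominated_cvg measurableT _ _ _ iah).
  - move=> n; apply/measurable_EFinP; apply/(measurable_restrictT _ _).1; first exact: mI.
    by apply: measurable_funTS; apply/measurable_EFinP; exact: measurable_int ih.
  - move=> t _; apply: cvg_EFin; first exact: nearW.
    apply: cvg_near_cst.
    have := @nbhs_infty_ger R `|t|; apply: filterS => n hn.
    rewrite /= patchE mem_set //= /I /= in_itv /= -ler_norml.
    by apply: le_trans hn _; rewrite ler_nat.
  - by [].
  - move=> n t _; rewrite lee_fin patchE; case: ifP => // _.
    by rewrite normr0.
have : (fun n => \int[leb]_t ((h' \_ (I n)) t)%:E)%E = EFin \o (fun n => h n.+1%:R - h (- n.+1%:R)).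
  apply/funext => n /=; rewrite -E [RHS]integral_mkcond.
  by apply: eq_integral => t _; rewrite restrict_EFin.
move=> EE; rewrite EE in limI.
have L0 : (EFin \o (fun n => h n.+1%:R - h (- n.+1%:R))) n @[n --> \oo] --> (0:R)%:E.
  by apply: cvg_EFin; [exact: nearW|exact: lim0].
by rewrite /Rintegral (cvg_unique _ limI L0).
Qed.

Lemma gauss_le (t : R) : gauss_fun t <= 1 / (1 + t ^+ 2).
Proof.
rewrite ler_pdivlMr ?oneDsq_gt0 // /gauss_fun -(ler_pM2l (expR_gt0 (t ^+ 2))).
by rewrite mulrA expRxMexpNx_1 mul1r mulr1 expR_ge1Dx.
Qed.

Lemma tgauss_le (t : R) : `|t| * gauss_fun t <= 2 / (1 + t ^+ 2).
Proof.
rewrite ler_pdivlMr ?oneDsq_gt0 // /gauss_fun -(ler_pM2l (expR_gt0 (t ^+ 2))).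
have -> : expR (t ^+ 2) * (`|t| * expR (- t ^+ 2) * (1 + t ^+ 2)) =
    expR (t ^+ 2) * expR (- t ^+ 2) * (`|t| * (1 + t ^+ 2)) by ring.
rewrite expRxMexpNx_1 mul1r.
have := @expR_ge1Dxn _ (t ^+ 2) 1 (sqr_ge0 _).
have := @expR_ge1Dx _ (t ^+ 2).
rewrite -[t ^+ 2]real_normK ?num_real //.
have -> : (2`!)%:R = 2 :> R by [].
move: (normr_ge0 t); move: `|t| => s s0; move: (expR _) => e h1 h2.
have : 1 + (s ^+ 2) ^+ 2 / 2 <= e by [].
(* This says [2 s (1 + s^2) <= (1 + s^2)^2]; the two lower bounds on the exponential dominate the
   right side. *)
have : 0 <= (1 - s) ^+ 2 * (1 + s ^+ 2) by rewrite mulr_ge0 ?sqr_ge0 ?ltW ?oneDsq_gt0.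
by nra.
Qed.

Lemma is_derive_gauss (t : R) : is_derive t 1 (@gauss_fun R) (- 2 * t * gauss_fun t).
Proof.
rewrite /gauss_fun; apply: is_derive_eq.
by rewrite !scaleRE; ring.
Qed.

Lemma is_derive_cosA (A q t : R) : is_derive t 1 (fun t => cos (A + q * t)) (- q * sin (A + q * t)).
Proof. by apply: is_derive_eq; rewrite !scaleRE; ring. Qed.

Lemma is_derive_sinA (A q t : R) : is_derive t 1 (fun t => sin (A + q * t)) (q * cos (A + q * t)).
Proof. by apply: is_derive_eq; rewrite !scaleRE; ring. Qed.

Lemma continuous_cosA (A q : R) : continuous (fun t : R => cos (A + q * t)).
Proof.
move=> t; apply: differentiable_continuous; apply/derivable1_diffP.
exact: (@ex_derive _ _ _ _ _ _ _ (is_derive_cosA A q t)).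
Qed.

Lemma continuous_sinA (A q : R) : continuous (fun t : R => sin (A + q * t)).
Proof.
move=> t; apply: differentiable_continuous; apply/derivable1_diffP.
exact: (@ex_derive _ _ _ _ _ _ _ (is_derive_sinA A q t)).
Qed.

Lemma integrable_dom (u : R -> R) (c : R) : continuous u ->
  (forall t, `|u t| <= c / (1 + t ^+ 2)) -> leb.-integrable setT (EFin \o u).
Proof.
move=> cu bu; apply: (le_integrable measurableT _ _ (integrable_oneDsqr c)).
  by apply/measurable_EFinP; exact: continuous_measurable_fun.
by move=> t _; rewrite /= lee_fin; apply: le_trans (bu t) (ler_norm _).
Qed.

(** The phase [A] carries the contribution of the outer coordinates in an iterated integral;
    shifting it by [pi / 2] also covers sines. *)
Definition gF (A q : R) : R := Rintegral leb setT (fun t => cos (A + q * t) * gauss_fun t).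

Lemma integrable_cosg A q : leb.-integrable setT (EFin \o (fun t => cos (A + q * t) * gauss_fun t)).
Proof.
apply: (@integrable_dom _ 1) => t.
  by apply: cvgM; [exact: continuous_cosA|exact: continuous_gauss_fun].
rewrite normrM (ger0_norm (gauss_fun_ge0 _)); apply: le_trans (gauss_le t).
by rewrite ler_piMl ?gauss_fun_ge0 ?norm_cos_le1.
Qed.

Lemma integrable_sing A q :
  leb.-integrable setT (EFin \o (fun t => t * sin (A + q * t) * gauss_fun t)).
Proof.
apply: (@integrable_dom _ 2) => t.
  apply: cvgM; last exact: continuous_gauss_fun.
  by apply: cvgM; [exact: cvg_id|exact: continuous_sinA].
rewrite !normrM (ger0_norm (gauss_fun_ge0 _)); apply: le_trans (tgauss_le t).
by rewrite ler_wpM2r ?gauss_fun_ge0 // ler_piMr ?norm_sin_le1.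
Qed.

(* The integral of the derivative of [sin (A + q t) exp (- t^2)] vanishes. *)
Lemma gauss_parts A q :
  2 * Rintegral leb setT (fun t => t * sin (A + q * t) * gauss_fun t) = q * gF A q.
Proof.
have H := @Rintegral_derive0 (fun t => sin (A + q * t) * gauss_fun t)
  (fun t => q * (cos (A + q * t) * gauss_fun t) - 2 * (t * sin (A + q * t) * gauss_fun t)) 1.
have iq : leb.-integrable setT (EFin \o (fun t => q * (cos (A + q * t) * gauss_fun t))).
  exact: (integrableZl measurableT q (integrable_cosg A q)).
have i2 : leb.-integrable setT (EFin \o (fun t => 2 * (t * sin (A + q * t) * gauss_fun t))).
  exact: (integrableZl measurableT 2 (integrable_sing A q)).
have {}H := H _ _ (integrableB measurableT iq i2).
have : Rintegral leb setT (fun t => q * (cos (A + q * t) * gauss_fun t) -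
    2 * (t * sin (A + q * t) * gauss_fun t)) = 0.
  apply: H.
  - move=> t; have d1 := is_derive_sinA A q t; have d2 := is_derive_gauss t.
    apply: (is_derive_eq (is_deriveM d1 d2)); rewrite !scaleRE; ring.
  - move=> t; apply: cvgB; (apply: cvgM; first exact: cvg_cst).
      by apply: cvgM; [exact: continuous_cosA|exact: continuous_gauss_fun].
    apply: cvgM; last exact: continuous_gauss_fun.
    by apply: cvgM; [exact: cvg_id|exact: continuous_sinA].
  - move=> t; rewrite normrM (ger0_norm (gauss_fun_ge0 _)); apply: le_trans (gauss_le t).
    by rewrite ler_piMl ?gauss_fun_ge0 ?norm_sin_le1.
rewrite RintegralB // !RintegralZl //; [|exact: integrable_sing|exact: integrable_cosg].
by move=> /eqP; rewrite subr_eq0 => /eqP ->.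
Qed.

(** Differentiation under the integral sign with majorant [|t| * gauss_fun t], followed by the
    integration by parts [gauss_parts], yields a linear differential equation in [q]. *)
Lemma is_derive_gF (A q : R) : is_derive q 1 (gF A) (- (q / 2) * gF A q).
Proof.
pose f (q t : R) := cos (A + q * t) * gauss_fun t.
have df (q' t : R) : is_derive q' 1 (f ^~ t) (- (t * sin (A + q' * t) * gauss_fun t)).
  rewrite /f; apply: is_derive_eq; rewrite !scaleRE; ring.
have d1E : partial1of2 f q = fun t => - (t * sin (A + q * t) * gauss_fun t).
  by apply/funext => t; rewrite partial1of2E (@derive_val _ _ _ _ _ _ _ (df q t)).
have Iq : (`](q - 1), (q + 1)[%classic : set R) q by rewrite /= in_itv /=; lra.
have i1 : forall x : R, (`](q - 1), (q + 1)[%classic : set R) x ->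
  leb.-integrable setT (EFin \o f x) by move=> x _; exact: integrable_cosg.
have d1 : forall (x : R) (y : R), (`](q - 1), (q + 1)[%classic : set R) x ->
  setT y -> derivable (f ^~ y) x 1 by move=> x y _ _; exact: (@ex_derive _ _ _ _ _ _ _ (df x y)).
have g0 (y : R) : 0 <= `|y| * gauss_fun y by rewrite mulr_ge0 ?gauss_fun_ge0.
have ig : leb.-integrable setT (EFin \o (fun y : R => `|y| * gauss_fun y)).
  apply: (@integrable_dom _ 2) => t; last by rewrite ger0_norm ?tgauss_le.
  by apply: cvgM; [exact: norm_continuous|exact: continuous_gauss_fun].
have gu : forall (x y : R), (`](q - 1), (q + 1)[%classic : set R) x -> setT y ->
  `|partial1of2 f x y| <= `|y| * gauss_fun y.
  move=> x y _ _; rewrite partial1of2E (@derive_val _ _ _ _ _ _ _ (df x y)).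
  rewrite normrN !normrM (ger0_norm (gauss_fun_ge0 _)).
  by rewrite ler_wpM2r ?gauss_fun_ge0 // ler_piMr ?norm_sin_le1.
have D := derivable_under_integral measurableT Iq i1 d1 g0 ig gu.
have V := differentiation_under_integral measurableT Iq i1 d1 g0 ig gu.
apply: DeriveDef; first exact: D.
rewrite -derive1E [LHS]V.
have -> : Rintegral leb setT (fun y => partial1of2 f q y) =
    - Rintegral leb setT (fun t => t * sin (A + q * t) * gauss_fun t).
  rewrite d1E -mulN1r -RintegralZl //; last exact: integrable_sing.
  by apply: eq_Rintegral => t _; rewrite mulN1r.
have := gauss_parts A q.
by move: (Rintegral _ _ _) => z hz; rewrite mulNr mulrAC -hz mulrAC divff ?mul1r.
Qed.

(** The differential equation is solved with the integrating factor [expR (q ^+ 2 / 4)]; the value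
    at 0 is the Gaussian integral times [cos A]. *)
Lemma gFE (A q : R) : gF A q = cos A * (Num.sqrt pi * expR (- (q ^+ 2 / 4))).
Proof.
pose h q := gF A q * expR (q ^+ 2 / 4).
have dh (r : R) : is_derive r 1 h 0.
  have d1 := is_derive_gF A r.
  have d2 : is_derive r 1 (fun r : R => expR (r ^+ 2 / 4)) (r / 2 * expR (r ^+ 2 / 4)).
    by apply: is_derive_eq; rewrite !scaleRE; field.
  apply: (is_derive_eq (is_deriveM d1 d2)); rewrite !scaleRE; ring.
have := is_derive_0_is_cst q 0 dh; rewrite /h.
have -> : gF A 0 = cos A * Num.sqrt pi.
  rewrite /gF; under eq_Rintegral do rewrite mul0r addr0.
  rewrite RintegralZl //; last exact: integrableT_gauss.
  by rewrite /Rintegral integralT_gauss.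
rewrite expr0n mul0r expR0 mulr1 mulrA => <-.
by rewrite -mulrA expRxMexpNx_1 mulr1.
Qed.

Lemma gauss_int (A q K : R) : Rintegral leb setT (fun t => cos (A + q * t) * (K * gauss_fun t)) =
  cos A * (K * (Num.sqrt pi * expR (- (q ^+ 2 / 4)))).
Proof.
rewrite mulrCA -gFE -RintegralZl //; last exact: integrable_cosg.
by apply: eq_Rintegral => t _; rewrite mulrCA.
Qed.

Definition gauss_hat (p : M) : R := let G q := Num.sqrt pi * expR (- (q ^+ 2 / 4)) in
  G p.1.1 * G p.1.2 * G p.2.1 * G p.2.2.

Lemma gauss_hat_gt0 p : 0 < gauss_hat p.
Proof. by rewrite /gauss_hat !mulr_gt0 ?expR_gt0 ?sqrtr_gt0 ?pi_gt0. Qed.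

Lemma gauss4E (a b c d : R) : gauss4 ((a, b), (c, d)) =
  gauss_fun a * gauss_fun b * gauss_fun c * gauss_fun d.
Proof. by rewrite /gauss4 /gauss_fun /eucl2 /= -!expRD -!opprD. Qed.

(** Each integration, innermost coordinate first, returns the cosine of the remaining phase times a
    constant, so the shape is preserved. The reorderings put the next Gaussian factor last, where
    [gauss_int] expects it. The sign of the time coordinate disappears in the square. *)
Lemma int4_gauss (A : R) (p : M) :
  int4 (fun x => cos (A + lorentz p x) * gauss4 x) = cos A * gauss_hat p.
Proof.
rewrite /int4 /Defs.leb.
under eq_Rintegral => x0 _.
  under eq_Rintegral => x1 _.
    under eq_Rintegral => x2 _.
      under eq_Rintegral => x3 _ do rewrite gauss4E /lorentz /= !addrA.
      rewrite gauss_int.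
      have -> : gauss_fun x0 * gauss_fun x1 * gauss_fun x2 *
          (Num.sqrt pi * expR (- (p.2.2 ^+ 2 / 4))) = 
        gauss_fun x0 * gauss_fun x1 * 
          (Num.sqrt pi * expR (- (p.2.2 ^+ 2 / 4))) * gauss_fun x2 by ring.
      over.
    rewrite gauss_int.
    set K := Num.sqrt pi * expR (- (p.2.2 ^+ 2 / 4)).
    set L := Num.sqrt pi * expR (- (p.2.1 ^+ 2 / 4)).
    have -> : gauss_fun x0 * gauss_fun x1 * K * L = gauss_fun x0 * K * L * gauss_fun x1 by ring.
    over.
  rewrite gauss_int -mulNr.
  set K := Num.sqrt pi * expR (- (p.2.2 ^+ 2 / 4)).
  set L := Num.sqrt pi * expR (- (p.2.1 ^+ 2 / 4)).
  set N := Num.sqrt pi * expR (- (p.1.2 ^+ 2 / 4)).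
  have -> : gauss_fun x0 * K * L * N = K * L * N * gauss_fun x0 by ring.
  over.
rewrite gauss_int sqrrN /gauss_hat; congr (_ * _); ring.
Qed.

Definition gaussC (x : M) : Cx R := cmk (gauss4 x) 0.

Lemma schwartz_gaussC : schwartz gaussC.
Proof.
have [sg rg] := rschwartz_gauss4 R.
have E1 : cRe (R:=R) \o gaussC = @gauss4 R by [].
have E2 : cIm (R:=R) \o gaussC = fun=> 0 by [].
rewrite /schwartz E1 E2; split => //; split; last split => //.
  by move=> l i x; rewrite pderiv_cst0; exact: derivable_cst.
move=> l k; exists 0 => x; rewrite pderiv_cst0 normr0 mulr0 //.
Qed.

Lemma fourier_gaussC p : fourier gaussC p = cmk (gauss_hat p) 0.
Proof.
rewrite /fourier; congr cmk.
  have -> : (fun x => cRe (expi (lorentz p x) * gaussC x)) =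
      (fun x => cos (0 + lorentz p x) * gauss4 x).
    by apply/funext => x; rewrite cReM /= mulr0 subr0 add0r.
  by rewrite int4_gauss cos0 mul1r.
(* The sine is a cosine with phase shifted by [- (pi / 2)], so the integral carries the factor
   [cos (- (pi / 2)) = 0]. *)
have -> : (fun x => cIm (expi (lorentz p x) * gaussC x)) =
    (fun x => cos (- (pi / 2) + lorentz p x) * gauss4 x).
  apply/funext => x; rewrite cImM /= mulr0 add0r.
  by rewrite addrC -sinDpihalf subrK.
by rewrite int4_gauss cosN cos_pihalf mul0r.
Qed.

End GaussianFourier.

(** * Square-summable sequences and their inner product *)

Section SquareSummable.
Variable R : realType.
Local Notation C := (Cx R).
Implicit Types v w : seqv R.

(** The real counterpart of [sqnorm v < +oo], in the form used by comparison tests for real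
    series. *)
Definition l2 v := cvgn (series (fun j => cabs2 (v j))).

Lemma series_cabs2_nd v : nondecreasing_seq (series (fun j => cabs2 (v j))).
Proof. by apply: nondecreasing_series => n _ _; exact: cabs2_ge0. Qed.

Lemma sqnorm_lim v : l2 v -> sqnorm v = (limn (series (fun j => cabs2 (v j))))%:E.
Proof.
move=> cv; rewrite /sqnorm -EFin_lim //; congr (limn _).
by apply/funext => n /=; rewrite sumEFin.
Qed.

Lemma sqnorm_l2 v : (sqnorm v < +oo)%E <-> l2 v.
Proof.
split=> [vf|/sqnorm_lim -> ]; last exact: ltry.
apply: nondecreasing_is_cvgn; first exact: series_cabs2_nd.
exists (fine (sqnorm v)) => _ [n _ <-].
have s0 : (0 <= sqnorm v)%E by apply: nneseries_ge0 => j _ _; rewrite lee_fin cabs2_ge0.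
rewrite -lee_fin fineK; last by rewrite ge0_fin_numE.
rewrite /series /= -sumEFin /sqnorm.
by apply: nneseries_lim_ge => j _; rewrite lee_fin cabs2_ge0.
Qed.

Lemma sqnorm_ge0 v : (0 <= sqnorm v)%E.
Proof. by apply: nneseries_ge0 => j _ _; rewrite lee_fin cabs2_ge0. Qed.

Lemma series_eventually0 (a : nat -> R) n : (forall j, (n < j)%N -> a j = 0) ->
  series a @ \oo --> \sum_(0 <= j < n.+1) a j.
Proof.
move=> a0; apply: cvg_near_cst; near=> m.
have nm : (n.+1 <= m)%N by near: m; exact: nbhs_infty_ge.
rewrite /series /= (big_cat_nat _ nm) //= (_ : \sum_(n.+1 <= i < m) a i = 0) ?addr0 //.
by rewrite big_nat big1 // => j /andP[nj _]; exact: a0.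
Unshelve. all: end_near. Qed.

Lemma inH_l2 o v : inH o v -> l2 v.
Proof.
case: o => [n /= v0|/= /sqnorm_l2 //].
apply/cvg_ex; eexists; apply: (@series_eventually0 _ n) => j nj.
by rewrite v0 // /cabs2 /= !expr0n addr0.
Qed.

Lemma l2_le (F : nat -> R) v w : l2 v -> l2 w ->
  (forall j, `|F j| <= cabs2 (v j) + cabs2 (w j)) ->
  cvgn (series F) /\
  `|limn (series F)| <= limn (series (fun j => cabs2 (v j))) + limn (series (fun j => cabs2 (w j))).
Proof.
move=> lv lw HF.
have cvw := is_cvg_seriesD lv lw.
have cn : cvgn (series (fun j => `|F j|)).
  by apply: (series_le_cvg _ _ HF cvw) => j //; rewrite addr_ge0 ?cabs2_ge0.
have cF : cvgn (series F) by exact: normed_cvg.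
split => //; rewrite -limD //.
apply: le_trans (lim_series_norm cn) _.
rewrite -seriesD; apply: lim_series_le => //; exact: cvw.
Qed.

Definition reT v w j := cRe (cconj (v j) * w j).
Definition imT v w j := cIm (cconj (v j) * w j).

Lemma reT_le v w j : `|reT v w j| <= cabs2 (v j) + cabs2 (w j).
Proof.
rewrite /reT cReM /cconj /cabs2 /=.
move: (cRe _) (cIm _) (cRe _) (cIm _) => a b c d.
rewrite ler_norml; have := sqr_ge0 (a - c); have := sqr_ge0 (a + c).
by have := sqr_ge0 (b - d); have := sqr_ge0 (b + d);
  have := sqr_ge0 a; have := sqr_ge0 b; have := sqr_ge0 c; have := sqr_ge0 d; nra.
Qed.

Lemma imT_le v w j : `|imT v w j| <= cabs2 (v j) + cabs2 (w j).
Proof.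
rewrite /imT cImM /cconj /cabs2 /=.
move: (cRe _) (cIm _) (cRe _) (cIm _) => a b c d.
rewrite ler_norml; have := sqr_ge0 (a - d); have := sqr_ge0 (a + d).
by have := sqr_ge0 (b - c); have := sqr_ge0 (b + c);
  have := sqr_ge0 a; have := sqr_ge0 b; have := sqr_ge0 c; have := sqr_ge0 d; nra.
Qed.

Lemma reT_cvg v w : l2 v -> l2 w -> cvgn (series (reT v w)).
Proof. by move=> lv lw; have [] := l2_le lv lw (reT_le v w). Qed.

Lemma imT_cvg v w : l2 v -> l2 w -> cvgn (series (imT v w)).
Proof. by move=> lv lw; have [] := l2_le lv lw (imT_le v w). Qed.

(** Weaker than Cauchy-Schwarz, but linear in [sqnorm], so the right side is integrable as it stands
    for square-integrable vectors. *)
Lemma fip_bound v w : l2 v -> l2 w ->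
  `|cRe (fip v w)| <= fine (sqnorm v) + fine (sqnorm w) /\
  `|cIm (fip v w)| <= fine (sqnorm v) + fine (sqnorm w).
Proof.
move=> lv lw; rewrite !sqnorm_lim //=.
by split; [have [] := l2_le lv lw (reT_le v w)|have [] := l2_le lv lw (imT_le v w)].
Qed.

Lemma lim_series_lin2 (a b : nat -> R) (s t : R) : cvgn (series a) -> cvgn (series b) ->
  limn (series (fun j => s * a j + t * b j)) = s * limn (series a) + t * limn (series b).
Proof.
move=> ca cb; apply/cvg_lim => //.
have -> : series (fun j => s * a j + t * b j) = fun n => s * series a n + t * series b n.
  by apply/funext => n; rewrite /series /= !mulr_sumr -big_split.
by apply: cvgD; (apply: cvgM; first exact: cvg_cst); [exact: ca|exact: cb].
Qed.

Lemma fipZ v w (c : C) : l2 v -> l2 w -> fip v (fun j => c * w j) = c * fip v w.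
Proof.
move=> lv lw; have rv := reT_cvg lv lw; have iv := imT_cvg lv lw.
have cE (z : C) : z = cmk (cRe z) (cIm z) by case: z.
rewrite [RHS]cE /fip; congr cmk.
  rewrite cReM /= -/(reT v w) -/(imT v w) -mulNr -lim_series_lin2 //.
  congr (limn (series _)); apply/funext => j.
  by rewrite /reT /imT !cReM !cImM /=; ring.
rewrite cImM /= -/(reT v w) -/(imT v w) -lim_series_lin2 //.
congr (limn (series _)); apply/funext => j.
by rewrite /reT /imT !cReM !cImM /= !cReM /=; ring.
Qed.

Lemma fipB v w w' : l2 v -> l2 w -> l2 w' ->
  fip v (fun j => w j - w' j) = fip v w - fip v w'.
Proof.
move=> lv lw lw'.
have cE (z : C) : z = cmk (cRe z) (cIm z) by case: z.
have cReB (a b : C) : cRe (a - b) = 1 * cRe a + (-1) * cRe b.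
  by rewrite cReD mul1r mulN1r; case: b.
have cImB (a b : C) : cIm (a - b) = 1 * cIm a + (-1) * cIm b.
  by rewrite cImD mul1r mulN1r; case: b.
rewrite [RHS]cE /fip; congr cmk.
  rewrite cReB /= -/(reT v w) -/(reT v w') -lim_series_lin2; [|exact: reT_cvg..].
  congr (limn (series _)); apply/funext => j.
  by rewrite mulrBr cReB.
rewrite cImB /= -/(imT v w) -/(imT v w') -lim_series_lin2; [|exact: imT_cvg..].
congr (limn (series _)); apply/funext => j.
by rewrite mulrBr cImB.
Qed.

Lemma l2Z v (c : C) : l2 v -> l2 (fun j => c * v j).
Proof.
move=> lv.
rewrite /l2; have -> : (fun j => cabs2 (c * v j)) = (fun j => cabs2 c *: cabs2 (v j)).
  by apply/funext => j; rewrite /cabs2 cReM cImM scaleRE; ring.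
by apply: is_cvg_seriesZ.
Qed.

Lemma l2B v w : l2 v -> l2 w -> l2 (fun j => v j - w j).
Proof.
move=> lv lw.
have c2 : cvgn (series (2 *: ((fun j => cabs2 (v j)) + (fun j => cabs2 (w j))))).
  by apply: is_cvg_seriesZ; exact: is_cvg_seriesD.
apply: (series_le_cvg _ _ _ c2) => j; rewrite ?cabs2_ge0 //.
  by rewrite !fctE mulr_ge0 // addr_ge0 ?cabs2_ge0.
rewrite !fctE /cabs2 !cReD !cImD.
have -> : cRe (- w j) = - cRe (w j) by case: (w j).
have -> : cIm (- w j) = - cIm (w j) by case: (w j).
move: (cRe _) (cIm _) (cRe _) (cIm _) => a b c d; rewrite scaleRE.
have := sqr_ge0 (a + c); have := sqr_ge0 (b + d); nra.
Qed.

(** Expand the squared norm of [v - w] and drop that of [w]. When the pairing integrates to 0, this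
    bounds the norm of [v] by its distance to [w]. *)
Lemma sqnorm_sub v w : l2 v -> l2 w ->
  (sqnorm v <= sqnorm (fun j => v j - w j)%R + (2 * cRe (fip w v))%:E)%E.
Proof.
move=> lv lw; have lvw := l2B lv lw; have rwv := reT_cvg lw lv.
rewrite !sqnorm_lim // -EFinD lee_fin /= -/(reT w v).
rewrite -[X in _ <= X + _]mul1r -lim_series_lin2 //.
have c1 : cvgn (series (fun j => 1 * cabs2 (v j - w j) + 2 * reT w v j)).
  have C1 : cvgn (series (1 *: (fun j => cabs2 (v j - w j)))) by apply: is_cvg_seriesZ.
  have C2 : cvgn (series (2 *: (reT w v))) by apply: is_cvg_seriesZ.
  exact: is_cvg_seriesD C1 C2.
apply: lim_series_le => // j; rewrite /reT cReM /cconj /cabs2 !cReD !cImD /=.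
have -> : cRe (- w j) = - cRe (w j) by case: (w j).
have -> : cIm (- w j) = - cIm (w j) by case: (w j).
move: (cRe _) (cIm _) (cRe _) (cIm _) => a b c d.
have := sqr_ge0 c; have := sqr_ge0 d; nra.
Qed.

Lemma l2_0 : l2 (fun=> 0).
Proof. by apply: (@inH_l2 (Some 0%N)). Qed.

Lemma fip0 v : fip (fun=> 0) v = 0.
Proof.
have E : (fun j => cRe (cconj 0 * v j)) = fun=> 0 :> R.
  by apply/funext => j; rewrite cReM /= mul0r oppr0 mul0r subrr.
have E' : (fun j => cIm (cconj 0 * v j)) = fun=> 0 :> R.
  by apply/funext => j; rewrite cImM /= mul0r oppr0 mul0r addr0.
rewrite /fip E E'; have -> : series (fun=> 0 : R) = fun=> 0.
  by apply/funext => n; rewrite /series /= big1.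
by rewrite lim_cst.
Qed.

Lemma sqnorm_eq0 v : sqnorm v = 0%E -> v = fun=> 0.
Proof.
move=> v0; apply/funext => j.
have le0 : \sum_(0 <= i < j.+1) cabs2 (v i) <= 0.
  rewrite -lee_fin -sumEFin -[X in (_ <= X)%E]v0 /sqnorm.
  by apply: nneseries_lim_ge => i _ _; rewrite lee_fin cabs2_ge0.
have {}le0 : cabs2 (v j) <= 0.
  apply: le_trans le0; rewrite big_nat_recr //= lerDr sumr_ge0 // => i _.
  exact: cabs2_ge0.
move: le0; rewrite /cabs2 /cRe /cIm; case: (v j) => a b /= le0.
have a0 : a = 0.
  by apply/eqP; rewrite -sqrf_eq0 eq_le sqr_ge0 andbT; have := sqr_ge0 b; lra.
have b0 : b = 0.
  by apply/eqP; rewrite -sqrf_eq0 eq_le sqr_ge0 andbT; have := sqr_ge0 a; lra.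
by rewrite a0 b0.
Qed.

Definition unitv (j : nat) : seqv R := fun i => (i == j)%:R.

(** Connects weak measurability, tested by inner products, with measurability of coordinates. *)
Lemma fip_unit j v : fip (unitv j) v = v j.
Proof.
have H (F : C -> R) : F 0 = 0 ->
    limn (series (fun i => F (cconj (unitv j i) * v i))) = F (v j).
  move=> F0.
  have E i : F (cconj (unitv j i) * v i) = if i == j then F (v j) else 0.
    rewrite /unitv; case: eqP => [->|_] /=.
      by congr F; case: (v j) => a b; rewrite /cconj /cmk /=; simpc.
    by rewrite -[RHS]F0; congr F; case: (v i) => a b; rewrite /cconj /cmk /=; simpc.
  apply/cvg_lim => //; under eq_fun do rewrite E.
  have S := @series_eventually0 (fun i => if i == j then F (v j) else 0) j.
  have Fv : \sum_(0 <= i < j.+1) (if i == j then F (v j) else 0) = F (v j).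
    rewrite big_nat_recr //= eqxx big_nat big1 ?add0r // => i /andP[_ ij].
    by rewrite (ltn_eqF ij).
  by rewrite Fv in S; apply: S => i ji; rewrite (gtn_eqF ji).
by rewrite /fip (H (@cRe R)) // (H (@cIm R)) //; case: (v j).
Qed.

End SquareSummable.

(** * The complement of the support is null *)

Section Support.
Variable R : realType.
Local Notation M := (Mn R).
Local Notation MB := (Mb R).

Lemma nbhs_rat (x : R) (A : set R) : nbhs x A ->
  exists ab : rat * rat, ratr ab.1 < x < ratr ab.2 /\
    `](ratr ab.1 : R), ratr ab.2[%classic `<=` A.
Proof.
move=> /nbhs_ballP[e /= e0 he].
have [a] : exists a, ratr a \in `]x - e, x[ by apply: rat_in_itvoo; rewrite ltrBlDr ltrDl.
have [b] : exists b, ratr b \in `]x, x + e[ by apply: rat_in_itvoo; rewrite ltrDl.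
rewrite !in_itv /= => /andP[b1 b2] /andP[a1 a2].
exists (a, b); rewrite /= a2 b1; split=> // y; rewrite /= in_itv /= => /andP[y1 y2].
apply: he; rewrite /ball /= ltr_norml; apply/andP; split; lra.
Qed.

(** Indices of the boxes with rational endpoints: a countable base of the topology of [M] made of
    sets of the product sigma-algebra, which ties the two structures together. *)
Definition ratbox : Type := ((rat * rat) * (rat * rat)) * ((rat * rat) * (rat * rat)).

Definition bx (q : ratbox) : set MB :=
  (`](ratr q.1.1.1 : R), ratr q.1.1.2[%classic `*` `](ratr q.1.2.1 : R), ratr q.1.2.2[%classic) `*`
  (`](ratr q.2.1.1 : R), ratr q.2.1.2[%classic `*` `](ratr q.2.2.1 : R), ratr q.2.2.2[%classic).

Lemma measurable_bx q : measurable (bx q).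
Proof. by do !apply: measurableX; exact: measurable_itv. Qed.

Lemma open_bx (U : set M) (p : M) : open U -> U p -> exists q, bx q p /\ bx q `<=` U.
Proof.
move=> oU Up; have : nbhs p U by exact: open_nbhs_nbhs.
case: p Up => -[p0 p1] [p2 p3] Up.
case=> -[A B] /= [[[A0 A1] /= [nA0 nA1] sA] [[B0 B1] /= [nB0 nB1] sB]] sU.
have [q0 [h0 s0]] := nbhs_rat nA0; have [q1 [h1 s1]] := nbhs_rat nA1.
have [q2 [h2 s2]] := nbhs_rat nB0; have [q3 [h3 s3]] := nbhs_rat nB1.
exists ((q0, q1), (q2, q3)); split; first by rewrite /bx /= !in_itv.
move=> [[x0 x1] [x2 x3]] /= [[/= i0 i1] [/= i2 i3]].
apply: (sU ((x0, x1), (x2, x3))); split => /=.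
  by apply: sA; split => /=; [exact: s0|exact: s1].
by apply: sB; split => /=; [exact: s2|exact: s3].
Qed.

Lemma open_measurable4 (U : set M) : open U -> measurable (U : set MB).
Proof.
move=> oU.
have -> : (U : set MB) = \bigcup_q (if `[< bx q `<=` U >] then bx q else set0).
  apply/seteqP; split=> [p Up|p [q _]].
    by have [q [qp qU]] := open_bx oU Up; exists q => //; case: asboolP.
  by case: asboolP => // qU /qU.
apply: countable_bigcupT_measurable => [|q]; first exact: countableP.
by case: asboolP => _ //; exact: measurable_bx.
Qed.

Variables (mu : {measure set MB -> \bar R}) (X : option nat -> set MB).
Hypothesis hX : dim_partition mu X.

Definition fibres : set MB := \bigcup_o X o.

Lemma fibresE : fibres = X None `|` \bigcup_n X (Some n).
Proof.
apply/seteqP; split=> [p [[n|] _ Xp]|p [Xp|[n _ Xp]]].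
- by right; exists n.
- by left.
- by exists None.
- by exists (Some n).
Qed.

Lemma measurable_fibres : measurable fibres.
Proof.
have [mX _] := hX.
rewrite fibresE; apply: measurableU => //; apply: bigcupT_measurable => n; exact: mX.
Qed.

(** The fibres cover exactly the support. A point outside it has an open null neighbourhood, hence
    lies in a null rational box, and there are countably many boxes. *)
Lemma negligible_fibresC : mu.-negligible (~` fibres).
Proof.
have [_ [_ SE]] := hX.
have [enc [dec decK]] : exists (enc : ratbox -> nat) dec, pcancel enc dec.
  by exists pickle, unpickle; exact: pickleK.
pose F (k : nat) : set MB := match dec k with
  | Some q => if mu (bx q) == 0%E then bx q else set0
  | None => set0 end.
have nF : mu.-negligible (\bigcup_k F k).
  apply: negligible_bigcup => k; rewrite /F.
  case: (dec k) => [q|]; last exact: negligible_set0.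
  case: ifP => [/eqP q0|_]; last exact: negligible_set0.
  by exists (bx q); split => //; exact: measurable_bx.
apply: negligibleS nF => p; rewrite /fibres /= SE /msupport /= => /existsNP[U] /not_implyP[oU] /not_implyP[Up /negP].
rewrite -leNgt => mU.
have [q [qp qU]] := open_bx oU Up.
have q0 : mu (bx q) = 0%E.
  apply/eqP; rewrite eq_le measure_ge0 andbT; apply: le_trans mU.
  apply: le_measure => //; rewrite inE; first exact: measurable_bx.
  exact: open_measurable4.
by exists (enc q) => //; rewrite /F decK q0 eqxx.
Qed.

End Support.

(** * Integrals of complex-valued functions *)

Section Integrals.
Context d (T : measurableType d) (R : realType) (mu : {measure set T -> \bar R}).

(** The integral of a nonnegative function is a supremum over simple functions below it, so
    monotonicity holds without measurability. This form suits representatives that are uncontrolled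
    off the fibres. *)
Lemma ge0_integral_mono (f g : T -> \bar R) : (forall x, 0 <= f x)%E ->
  (forall x, f x <= g x)%E -> (\int[mu]_x f x <= \int[mu]_x g x)%E.
Proof.
move=> f0 fg; have g0 x : (0 <= g x)%E by apply: le_trans (fg x).
rewrite !ge0_integralTE //.
apply: le_ereal_sup => _ [h hf <-]; exists h => //= x.
exact: le_trans (fg x).
Qed.

Lemma ae_eq_Rintegral (f g : T -> R) : measurable_fun setT f -> measurable_fun setT g ->
  {ae mu, forall x, f x = g x} -> Rintegral mu setT f = Rintegral mu setT g.
Proof.
move=> mf mg fg; congr fine; apply: ae_eq_integral => //.
- exact/measurable_EFinP.
- exact/measurable_EFinP.
by apply: filterS fg => x + _; move=> /= ->.
Qed.

Definition cmeasurable (F : T -> Cx R) :=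
  measurable_fun setT (fun x => cRe (F x)) /\ measurable_fun setT (fun x => cIm (F x)).

Lemma cmeasurableM F G : cmeasurable F -> cmeasurable G -> cmeasurable (fun x => F x * G x).
Proof.
move=> [f1 f2] [g1 g2]; split.
  by under eq_fun do rewrite cReM; apply: measurable_funB; apply: measurable_funM.
by under eq_fun do rewrite cImM; apply: measurable_funD; apply: measurable_funM.
Qed.

Lemma cmeasurableB F G : cmeasurable F -> cmeasurable G -> cmeasurable (fun x => F x - G x).
Proof.
move=> [f1 f2] [g1 g2]; split.
  by under eq_fun do rewrite cReD cReN; apply: measurable_funB.
by under eq_fun do rewrite cImD cImN; apply: measurable_funB.
Qed.

Lemma cmeasurable_sum (I : Type) (s : seq I) (F : I -> T -> Cx R) :
  (forall i, cmeasurable (F i)) -> cmeasurable (fun x => \sum_(i <- s) F i x).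
Proof.
move=> mF; split.
  by under eq_fun do rewrite cRe_sum; apply: measurable_sum => i; have [] := mF i.
by under eq_fun do rewrite cIm_sum; apply: measurable_sum => i; have [] := mF i.
Qed.

Lemma cmeasurable_cvg (F_ : nat -> T -> Cx R) F : (forall n, cmeasurable (F_ n)) ->
  (forall x, ccvg (F_ ^~ x) (F x)) -> cmeasurable F.
Proof.
move=> mF cF; split.
  apply: (measurable_fun_cvg (h := fun n x => cRe (F_ n x))).
    by move=> n; have [] := mF n.
  by move=> x _; have [] := cF x.
apply: (measurable_fun_cvg (h := fun n x => cIm (F_ n x))).
  by move=> n; have [] := mF n.
by move=> x _; have [] := cF x.
Qed.

Definition cint (F : T -> Cx R) : Cx R :=
  cmk (Rintegral mu setT (fun x => cRe (F x))) (Rintegral mu setT (fun x => cIm (F x))).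

Definition cintegrable (F : T -> Cx R) :=
  mu.-integrable setT (fun x => (cRe (F x))%:E) /\ mu.-integrable setT (fun x => (cIm (F x))%:E).

Lemma cintegrable_measurable F : cintegrable F -> cmeasurable F.
Proof. by move=> [f1 f2]; split; apply/measurable_EFinP; apply: measurable_int; eassumption. Qed.

Lemma cintegrable0 : cintegrable (fun=> 0).
Proof. by split; exact: integrable0. Qed.

Lemma cintegrableD F G : cintegrable F -> cintegrable G -> cintegrable (fun x => F x + G x).
Proof.
move=> [f1 f2] [g1 g2]; split.
  under eq_fun do rewrite cReD EFinD; exact: integrableD.
under eq_fun do rewrite cImD EFinD; exact: integrableD.
Qed.

Lemma cintD F G : cintegrable F -> cintegrable G ->
  cint (fun x => F x + G x) = cint F + cint G.
Proof.
move=> [f1 f2] [g1 g2]; rewrite /cint.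
under [X in cmk X _]eq_Rintegral do rewrite cReD.
under [X in cmk _ X]eq_Rintegral do rewrite cImD.
by rewrite !RintegralD.
Qed.

Lemma cintegrableZ (c : Cx R) F : cintegrable F -> cintegrable (fun x => c * F x).
Proof.
move=> [f1 f2]; split.
  under eq_fun do rewrite cReM EFinB !EFinM.
  by apply: integrableB => //; apply: integrableZl.
under eq_fun do rewrite cImM EFinD !EFinM.
by apply: integrableD => //; apply: integrableZl.
Qed.

Lemma cintZ (c : Cx R) F : cintegrable F -> cint (fun x => c * F x) = c * cint F.
Proof.
move=> [f1 f2]; rewrite /cint.
have i1 (r : R) : mu.-integrable setT (EFin \o (fun x => r * cRe (F x))).
  exact: (integrableZl measurableT r f1).
have i2 (r : R) : mu.-integrable setT (EFin \o (fun x => r * cIm (F x))).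
  exact: (integrableZl measurableT r f2).
under [X in cmk X _]eq_Rintegral do rewrite cReM.
under [X in cmk _ X]eq_Rintegral do rewrite cImM.
rewrite RintegralB // RintegralD //.
by rewrite !RintegralZl //; case: c {i1 i2} => a b.
Qed.

Lemma cint_sum (I : Type) (s : seq I) (F : I -> T -> Cx R) :
  (forall i, cintegrable (F i)) ->
  cintegrable (fun x => \sum_(i <- s) F i x) /\
  cint (fun x => \sum_(i <- s) F i x) = \sum_(i <- s) cint (F i).
Proof.
move=> iF; elim: s => [|i s [IH1 IH2]].
  rewrite big_nil; under eq_fun do rewrite big_nil; split; first exact: cintegrable0.
  by rewrite /cint /= !Rintegral_cst // !mul0r.
under eq_fun do rewrite big_cons; split; first exact: cintegrableD.
by rewrite big_cons -IH2 -cintD.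
Qed.

(** Dominated convergence: bounded multipliers leave [c] times the sum of the absolute values of
    both parts of [F] as an integrable majorant. *)
Lemma cint_mul_cvg (m_ : nat -> T -> Cx R) (m F : T -> Cx R) (c : R) :
  (forall n, cmeasurable (m_ n)) ->
  (forall n x, `|cRe (m_ n x)| <= c /\ `|cIm (m_ n x)| <= c) ->
  (forall x, ccvg (m_ ^~ x) (m x)) -> cintegrable F ->
  cRe (cint (fun x => m_ n x * F x)) @[n --> \oo] --> cRe (cint (fun x => m x * F x)).
Proof.
move=> mm bm cm iF; have [f1 f2] := iF.
have mF := cintegrable_measurable iF.
pose g x := (c%:E * (`|(cRe (F x))%:E| + `|(cIm (F x))%:E|))%E.
have ig : mu.-integrable setT g.
  by apply: integrableZl => //; apply: integrableD => //; apply: integrable_abse.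
have bd n x : (`|(cRe (m_ n x * F x))%:E| <= g x)%E.
  rewrite /g /= -EFinD -EFinM lee_fin cReM.
  apply: le_trans (ler_normB _ _) _; rewrite !normrM mulrDr.
  by have [b1 b2] := bm n x; apply: lerD; apply: ler_wpM2r.
have cv x : cRe (m_ n x * F x) @[n --> \oo] --> cRe (m x * F x).
  have [c1 c2] := cm x; rewrite cReM; under eq_fun do rewrite cReM.
  by apply: cvgB; apply: cvgM => //; exact: cvg_cst.
have mn n : measurable_fun setT (fun x => (cRe (m_ n x * F x))%:E).
  by apply/measurable_EFinP; have [] := cmeasurableM (mm n) mF.
have cvE x : (cRe (m_ n x * F x))%:E @[n --> \oo] --> (cRe (m x * F x))%:E.
  by apply: cvg_EFin; [exact: nearW|exact: cv].
have ml : measurable_fun setT (fun x => (cRe (m x * F x))%:E).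
  by apply: (emeasurable_fun_cvg _ _ mn) => x _; exact: cvE.
have [i0 _ H] := @dominated_convergence _ _ _ mu setT measurableT
  (fun n x => (cRe (m_ n x * F x))%:E) (fun x => (cRe (m x * F x))%:E) g mn ml
  (aeW _ (fun x _ => cvE x)) ig (aeW _ (fun x n _ => bd n x)).
apply: fine_cvg; rewrite fineK; last exact: integrable_fin_num.
exact: H.
Qed.

End Integrals.

(** * Vectors of the direct integral and globally measurable representatives *)

Section DirectIntegral.
Variable R : realType.
Local Notation M := (Mn R).
Local Notation MB := (Mb R).
Variables (mu : {measure set MB -> \bar R}) (X : option nat -> set MB).
Hypothesis hX : dim_partition mu X.
Implicit Types phi psi : MB -> seqv R.

Local Notation fib := (fibres X).

(** Conditions on the whole space rather than on each [X o], as integrals over [setT] require. *)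
Definition gvec phi := (forall p, l2 (phi p)) /\ (forall j, cmeasurable (fun p => phi p j)).

(* Representatives are arbitrary outside the fibres, a null set; setting them to 0
   there makes every coordinate measurable on the whole space. *)
Definition fibcut phi : MB -> seqv R := fun p => if `[< fib p >] then phi p else fun=> 0.

Lemma cut_ae phi : aeeq mu phi (fibcut phi).
Proof.
apply: negligibleS (negligible_fibresC hX) => p /= H Sp; apply: H.
by rewrite /fibcut; case: asboolP.
Qed.

(** On each [X o], either the unit vector of index [j] lies in the fibre and weak measurability
    applies to it, or coordinate [j] vanishes on the whole fibre. *)
Lemma coord_measurable phi : in_fibres X phi -> weakly_borel X phi -> forall j,
  measurable_fun fib (fun p => cRe (phi p j)) /\ measurable_fun fib (fun p => cIm (phi p j)).
Proof.
move=> fphi wphi j; have [mX _] := hX.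
have key o : measurable_fun (X o) (fun p => cRe (phi p j)) /\
             measurable_fun (X o) (fun p => cIm (phi p j)).
  have [hj|hj] : inH o (unitv R j) \/ forall v : seqv R, inH o v -> v j = 0.
    case: o => [n|]; last left.
      by have [jn|nj] := leqP j n; [left|right] => [i ni|v]; [rewrite /unitv gtn_eqF // (leq_ltn_trans jn)|exact].
    apply/sqnorm_l2; apply: (@inH_l2 _ (Some j)) => i ji.
    by rewrite /unitv gtn_eqF.
  - have [] := wphi o _ hj.
    by under eq_fun do rewrite fip_unit; under [in X in _ -> X -> _]eq_fun do rewrite fip_unit.
  - have Z (f : Cx R -> R) : measurable_fun (X o) (fun p => f (phi p j)).
      apply: (@eq_measurable_fun _ _ _ _ (X o) (fun=> f 0)); last exact: measurable_cst.
      by move=> p /set_mem Xp /=; rewrite (hj _ (fphi _ _ Xp)).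
    by split; exact: Z.
rewrite fibresE; split; apply/measurable_funU => //; try (exact: bigcupT_measurable);
  (split; [by have [] := key None|]); apply/measurable_fun_bigcup => // n; by have [] := key (Some n).
Qed.

Lemma gvec_cut phi : in_fibres X phi -> weakly_borel X phi -> gvec (fibcut phi).
Proof.
move=> fphi wphi; split=> [p|j].
  by rewrite /fibcut; case: asboolP => [[r _ Xp]|_]; [exact: inH_l2 (fphi _ _ Xp)|exact: l2_0].
have mS := measurable_fibres hX.
have [m1 m2] := coord_measurable fphi wphi j.
have H (f : Cx R -> R) : f 0 = 0 -> measurable_fun fib (fun p => f (phi p j)) ->
    measurable_fun setT (fun p => f (fibcut phi p j)).
  move=> f0 /(measurable_restrictT _ mS).1; congr measurable_fun; apply/funext => p.
  rewrite patchE /fibcut; have [h|h] := pselect (fib p).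
    by rewrite mem_set // asboolT.
  by rewrite memNset // asboolF.
by split; apply: H.
Qed.

Lemma measurable_sqnorm phi : gvec phi -> measurable_fun setT (fun p => sqnorm (phi p)).
Proof.
move=> [_ mphi]; apply: ge0_emeasurable_sum => [k x _ _|k _].
  by rewrite lee_fin cabs2_ge0.
apply/measurable_EFinP; have [m1 m2] := mphi k.
by apply: measurable_funD; apply: measurable_funX.
Qed.

Lemma measurable_fip phi psi : gvec phi -> gvec psi ->
  cmeasurable (fun p => fip (phi p) (psi p)).
Proof.
move=> [lp mp] [lq mq].
have mc j : cmeasurable (fun p => cconj (phi p j) * psi p j).
  apply: cmeasurableM => //; have [m1 m2] := mp j; split => //=.
  exact: measurable_funN.
split.
  apply: (measurable_fun_cvg (h := fun n p => series (reT (phi p) (psi p)) n)).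
    by move=> n; apply: measurable_sum => j; have [] := mc j.
  by move=> p _; exact: reT_cvg.
apply: (measurable_fun_cvg (h := fun n p => series (imT (phi p) (psi p)) n)).
  by move=> n; apply: measurable_sum => j; have [] := mc j.
by move=> p _; exact: imT_cvg.
Qed.

Lemma weakly_borel_gvec phi : gvec phi -> weakly_borel X phi.
Proof.
move=> gphi o v hv.
have gv : gvec (fun=> v).
  by split=> [_|j]; [exact: inH_l2 hv|split; exact: measurable_cst].
by have [m1 m2] := measurable_fip gv gphi; split; apply: measurable_funTS.
Qed.

Definition hvec phi := gvec phi /\ (\int[mu]_p sqnorm (phi p) < +oo)%E.

Lemma hvec_cut phi : dirint mu X phi -> hvec (fibcut phi).
Proof.
move=> [f1 [f2 f3]]; split; first exact: gvec_cut.
apply: le_lt_trans f3; apply: ge0_integral_mono => p; first exact: sqnorm_ge0.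
rewrite /fibcut; case: asboolP => // _.
rewrite (sqnorm_lim (@l2_0 R)).
have -> : (fun j : nat => cabs2 (0 : Cx R)) = fun=> 0.
  by apply/funext => j; rewrite /cabs2 /= !expr0n addr0.
have -> : series (fun=> 0 : R) = fun=> 0.
  by apply/funext => n; rewrite /series /= big1.
by rewrite lim_cst // sqnorm_ge0.
Qed.

Lemma hvec_integrable phi : hvec phi -> mu.-integrable setT (fun p => sqnorm (phi p)).
Proof.
move=> [gphi fphi]; apply/integrableP; split; first exact: measurable_sqnorm.
have -> : (\int[mu]_p `|sqnorm (phi p)| = \int[mu]_p sqnorm (phi p))%E => //.
by apply: eq_integral => p _; rewrite gee0_abs // sqnorm_ge0.
Qed.

Lemma sqnorm_fin phi p : gvec phi -> (fine (sqnorm (phi p)))%:E = sqnorm (phi p).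
Proof. by move=> [lphi _]; rewrite sqnorm_lim. Qed.

Lemma fip_cintegrable phi psi : hvec phi -> hvec psi ->
  cintegrable mu (fun p => fip (phi p) (psi p)).
Proof.
move=> hphi hpsi.
have ii := integrableD measurableT (hvec_integrable hphi) (hvec_integrable hpsi).
have [m1 m2] := measurable_fip hphi.1 hpsi.1.
have B p := fip_bound (hphi.1.1 p) (hpsi.1.1 p).
split; (apply: (le_integrable measurableT _ _ ii); first exact/measurable_EFinP);
  move=> p _ /=; rewrite [leRHS]gee0_abs ?adde_ge0 ?sqnorm_ge0 //;
  rewrite -(sqnorm_fin p hphi.1) -(sqnorm_fin p hpsi.1) -EFinD lee_fin;
  by have [] := B p.
Qed.

(** The first argument vanishes off the fibres, so cutting the second changes nothing pointwise.
    Going through [hip_ae] would require [gvec u], which an uncut representative may fail. *)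
Lemma hip_cut psi u : hip mu (fibcut psi) u = hip mu (fibcut psi) (fibcut u).
Proof.
have E p : fip (fibcut psi p) (u p) = fip (fibcut psi p) (fibcut u p).
  by rewrite /fibcut; case: asboolP => // _; rewrite !fip0.
by rewrite /hip; congr cmk; apply: eq_Rintegral => p _; rewrite E.
Qed.

Lemma hip_ae psi u u' : gvec psi -> gvec u -> gvec u' -> aeeq mu u u' ->
  hip mu psi u = hip mu psi u'.
Proof.
move=> gp gu gu' uu'.
have [m1 m2] := measurable_fip gp gu; have [n1 n2] := measurable_fip gp gu'.
by rewrite /hip; congr cmk; apply: ae_eq_Rintegral => //; apply: filterS uu' => p ->.
Qed.

End DirectIntegral.

(** * Combinations of translates and measurability of the Fourier transform *)

Section SchwartzSpace.
Variable R : realType.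
Local Notation M := (Mn R).
Implicit Types (u w : M -> R) (f g : M -> Cx R).

Lemma rschwartz_lin2 u w (b c : R) : rschwartz u -> rschwartz w ->
  rschwartz (fun z => b * u z + c * w z).
Proof.
move=> [su ru] [sw rw]; split=> [|l k]; first exact: smooth_lin2.
have [a ha] := ru l k; have [d hd] := rw l k.
exists (`|b| * a + `|c| * d) => x; rewrite pderiv_lin2 //.
have w0 : 0 <= (1 + eucl2 x) ^+ k by exact: ltW (wtX_gt0 x k).
apply: le_trans (ler_wpM2l w0 (ler_normD _ _)) _.
by rewrite !normrM mulrDr; apply: lerD; rewrite mulrCA ler_wpM2l.
Qed.

Lemma rschwartz_translate u y : rschwartz u -> rschwartz (fun z => u (z - y)).
Proof.
move=> [su ru].
have E l : pderiv l (fun z => u (z - y)) = fun z => pderiv l u (z - y).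
  elim: l => //= i l ->; apply/funext => x.
  by apply: (@derive_val _ _ _ _ _ _ _ (is_derive_translate _)); exact: su.
split=> [l i x|l k].
  by rewrite E; apply: (@ex_derive _ _ _ _ _ _ _ (is_derive_translate _)); exact: su.
(* Peetre's inequality moves the weight from [x] to [x - y] at a cost depending only on [y] and
   [k]. *)
have [c hc] := ru l k; exists (2 ^+ k * wt y ^+ k * c) => x; rewrite E.
rewrite -/(wt x); have {1}-> : x = y + (x - y) by rewrite addrC subrK.
apply: le_trans (ler_wpM2r (normr_ge0 _) (peetreX _ _ _)) _.
rewrite -[X in X <= _]mulrA ler_wpM2l //; last exact: hc.
by rewrite mulr_ge0 ?exprn_ge0 // ltW // wt_gt0.
Qed.

Lemma schwartzP f : schwartz f <-> rschwartz (@cRe R \o f) /\ rschwartz (@cIm R \o f).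
Proof. by split=> [[? [? [? ?]]]|[[? ?] [? ?]]]. Qed.

Lemma schwartz_lin2 f g (c d : Cx R) : schwartz f -> schwartz g ->
  schwartz (fun x => c * f x + d * g x).
Proof.
move=> /schwartzP[f1 f2] /schwartzP[g1 g2]; apply/schwartzP; split.
  have -> : @cRe R \o (fun x => c * f x + d * g x) = fun x =>
      1 * (cRe c * cRe (f x) + (- cIm c) * cIm (f x)) +
      1 * (cRe d * cRe (g x) + (- cIm d) * cIm (g x)).
    by apply/funext => x /=; rewrite cReD !cReM; ring.
  by apply: rschwartz_lin2; apply: rschwartz_lin2.
have -> : @cIm R \o (fun x => c * f x + d * g x) = fun x =>
    1 * (cRe c * cIm (f x) + cIm c * cRe (f x)) +
    1 * (cRe d * cIm (g x) + cIm d * cRe (g x)).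
  by apply/funext => x /=; rewrite cImD !cImM; ring.
by apply: rschwartz_lin2; apply: rschwartz_lin2.
Qed.

Lemma schwartz_translate f a : schwartz f -> schwartz (translate a f).
Proof.
move=> /schwartzP[f1 f2]; apply/schwartzP; split.
  exact: (rschwartz_translate a f1).
exact: (rschwartz_translate a f2).
Qed.

Lemma schwartz0 : schwartz (fun=> 0 : Cx R).
Proof.
have -> : (fun=> 0 : Cx R) = fun x => 0 * gaussC x + 0 * gaussC x.
  by apply/funext => x; rewrite !mul0r addr0.
by apply: schwartz_lin2; exact: schwartz_gaussC.
Qed.

Definition translates (I : Type) (s : seq I) (c : I -> Cx R) (a : I -> M) f x : Cx R :=
  \sum_(j <- s) c j * translate (a j) f x.

Lemma translates_nil (I : Type) (c : I -> Cx R) (a : I -> M) f :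
  translates [::] c a f = fun=> 0.
Proof. by apply/funext => x; rewrite /translates big_nil. Qed.

Lemma translates_cons (I : Type) (s : seq I) j (c : I -> Cx R) (a : I -> M) f :
  translates (j :: s) c a f = fun x => c j * translate (a j) f x + 1 * translates s c a f x.
Proof. by apply/funext => x; rewrite /translates big_cons mul1r. Qed.

Lemma schwartz_translates (I : Type) (s : seq I) (c : I -> Cx R) (a : I -> M) f :
  schwartz f -> schwartz (translates s c a f).
Proof.
move=> sf; elim: s => [|j s IH]; first by rewrite translates_nil; exact: schwartz0.
by rewrite translates_cons; apply: schwartz_lin2 => //; exact: schwartz_translate.
Qed.

Lemma measurable_lorentz (a : M) : measurable_fun setT (fun p : Mb R => lorentz a p).
Proof.
have m1 : measurable_fun setT (fun p : Mb R => p.1.1 : R) by exact: measurableT_comp.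
have m2 : measurable_fun setT (fun p : Mb R => p.1.2 : R) by exact: measurableT_comp.
have m3 : measurable_fun setT (fun p : Mb R => p.2.1 : R) by exact: measurableT_comp.
have m4 : measurable_fun setT (fun p : Mb R => p.2.2 : R) by exact: measurableT_comp.
by rewrite /lorentz; do 3 (apply: measurable_funD; last exact: measurable_funM);
  apply: measurable_funN; exact: measurable_funM.
Qed.

Lemma cmeasurable_expi (a : M) : cmeasurable (fun p : Mb R => expi (lorentz a p)).
Proof.
have m := measurable_lorentz a; split => /=.
  apply: (measurableT_comp (f := @cos R)) m.
  by apply: continuous_measurable_fun; exact: continuous_cos.
apply: (measurableT_comp (f := @sin R)) m.
by apply: continuous_measurable_fun; exact: continuous_sin.
Qed.

Lemma cmeasurable_cst (c : Cx R) : cmeasurable (fun _ : Mb R => c).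
Proof. by split; exact: measurable_cst. Qed.

Lemma cmeasurable_fsum n f : cmeasurable (fun p : Mb R => fourier_sum n f p).
Proof.
apply: cmeasurable_sum => j; apply: cmeasurableM; last exact: cmeasurable_expi.
exact: cmeasurable_cst.
Qed.

(** A pointwise limit of finite trigonometric sums, which bypasses measurability of integrals in a
    parameter. *)
Lemma cmeasurable_fourier f : schwartz f -> cmeasurable (fun p : Mb R => fourier f p).
Proof.
move=> sf; apply: (cmeasurable_cvg (F_ := fun n p => fourier_sum n f p)) => [n|p].
  exact: cmeasurable_fsum.
exact: fourier_sum_cvg.
Qed.

Lemma fourier_bound f : schwartz f -> exists c : R,
  forall p : Mb R, `|cRe (fourier f p)| <= c /\ `|cIm (fourier f p)| <= c.
Proof.
move=> sf; have [c c0 H] := fourier_sum_bound sf; exists c => p.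
have [c1 c2] := fourier_sum_cvg p sf; split.
  by apply: (cvgr_to_le (cvg_norm c1)); apply: nearW => n; have [] := H n p.
by apply: (cvgr_to_le (cvg_norm c2)); apply: nearW => n; have [] := H n p.
Qed.

Lemma cabs2_fourier_bound f : schwartz f -> exists c : R,
  forall p : Mb R, cabs2 (fourier f p) <= c.
Proof.
move=> sf; have [c H] := fourier_bound sf; exists (c ^+ 2 + c ^+ 2) => p.
have [b1 b2] := H p.
have sq (t : R) : `|t| <= c -> t ^+ 2 <= c ^+ 2.
  move=> tc; rewrite -[t ^+ 2]real_normK ?num_real //.
  by rewrite lerXn2r ?nnegrE // (le_trans (normr_ge0 t)).
rewrite /cabs2; move: (cRe _) (cIm _) b1 b2 => a b b1 b2.
exact: lerD (sq _ b1) (sq _ b2).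
Qed.

Definition lweight n (a : M -> Cx R) (j : (int * int) * (int * int)) : Cx R :=
  cmk (mesh R n ^+ 4) 0 * a (lat R n j).

(** The complex form of [lcomm], written with translates so that [Phi] can be evaluated on it by
    linearity and covariance. *)
Definition ccomm f n : M -> Cx R := fun x =>
  1 * translates (box n) (lweight n (@gaussC R)) (lat R n) f x +
  (-1) * translates (box n) (lweight n f) (lat R n) (@gaussC R) x.

Lemma schwartz_ccomm f n : schwartz f -> schwartz (ccomm f n).
Proof.
by move=> sf; apply: schwartz_lin2; apply: schwartz_translates => //; exact: schwartz_gaussC.
Qed.

(** Since the Gaussian is real, each part of [ccomm f n] is [lcomm] of the Gaussian and the same
    part of [f]. *)
Lemma ccomm_cvg f : schwartz f -> schwartz_cvg (ccomm f) (fun=> 0).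
Proof.
move=> sf; have [f1 f2] := (schwartzP f).1 sf.
have rg := rschwartz_gauss4 R.
have E1 n : @cRe R \o ccomm f n = lcomm (@gauss4 R) (@cRe R \o f) n.
  apply/funext => x; rewrite /= /ccomm /lcomm /lsum cReD mul1r mulN1r cReN !cRe_sum.
  by congr (_ - _); apply: eq_bigr => j _; rewrite /lweight !cReM !cImM /=; ring.
have E2 n : @cIm R \o ccomm f n = lcomm (@gauss4 R) (@cIm R \o f) n.
  apply/funext => x; rewrite /= /ccomm /lcomm /lsum cImD mul1r mulN1r cImN !cIm_sum.
  by congr (_ - _); apply: eq_bigr => j _; rewrite /lweight !cImM ?cReM /=; ring.
split; [under eq_fun do rewrite E1|under eq_fun do rewrite E2]; exact: lcomm_cvg.
Qed.

End SchwartzSpace.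

(** * Combinations of vectors with bounded multipliers *)

Section Combinations.
Variable R : realType.
Local Notation MB := (Mb R).
Variable mu : {measure set MB -> \bar R}.
Implicit Types (m : MB -> Cx R) (u v phi : MB -> seqv R).

Lemma gvec_mul m phi : cmeasurable m -> gvec phi -> gvec (fun p j => m p * phi p j).
Proof.
by move=> mm [l mp]; split=> [p|j]; [exact: l2Z|exact: cmeasurableM].
Qed.

Definition comb m1 m2 u v : MB -> seqv R := fun p j => m1 p * u p j - m2 p * v p j.

Lemma gvec_comb m1 m2 u v : cmeasurable m1 -> cmeasurable m2 -> gvec u -> gvec v ->
  gvec (comb m1 m2 u v).
Proof.
move=> mm1 mm2 /(gvec_mul mm1)[l1 n1] /(gvec_mul mm2)[l2 n2].
by split=> [p|j]; [exact: l2B|exact: cmeasurableB].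
Qed.

Lemma hvec_comb m1 m2 u v (c d : R) : cmeasurable m1 -> cmeasurable m2 ->
  (forall p, cabs2 (m1 p) <= c) -> (forall p, cabs2 (m2 p) <= d) ->
  hvec mu u -> hvec mu v -> hvec mu (comb m1 m2 u v).
Proof.
move=> mm1 mm2 Hc Hd hu hv; have ge := gvec_comb mm1 mm2 hu.1 hv.1; split => //.
have c0 : 0 <= c by apply: le_trans (Hc point); exact: cabs2_ge0.
have d0 : 0 <= d by apply: le_trans (Hd point); exact: cabs2_ge0.
(* The factors 2 come from the termwise bound [|a - b|^2 <= 2 |a|^2 + 2 |b|^2]. *)
have i1 := integrableZl measurableT (2 * c) (hvec_integrable hu).
have i2 := integrableZl measurableT (2 * d) (hvec_integrable hv).
have /integrableP[_] := integrableD measurableT i1 i2.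
apply: le_lt_trans; apply: ge0_integral_mono => p; first exact: sqnorm_ge0.
rewrite /= gee0_abs; last first.
  by rewrite adde_ge0 // mule_ge0 ?sqnorm_ge0 // lee_fin mulr_ge0.
have lu := hu.1.1 p; have lv := hv.1.1 p; have lc := ge.1 p.
rewrite (sqnorm_lim lc) (sqnorm_lim lu) (sqnorm_lim lv).
rewrite -!EFinM -EFinD lee_fin -lim_series_lin2 //.
apply: lim_series_le => //.
  have C1 : cvgn (series ((2 * c) *: (fun j => cabs2 (u p j)))) by apply: is_cvg_seriesZ.
  have C2 : cvgn (series ((2 * d) *: (fun j => cabs2 (v p j)))) by apply: is_cvg_seriesZ.
  exact: is_cvg_seriesD C1 C2.
move=> j; apply: le_trans (cabs2B _ _) _; rewrite !cabs2M -!mulrA.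
by apply: lerD; rewrite ler_wpM2l // ler_wpM2r // cabs2_ge0.
Qed.

Lemma inHZ o (w : seqv R) (c : Cx R) : inH o w -> inH o (fun j => c * w j).
Proof.
case: o => [n h j nj|h]; first by rewrite h // mulr0.
by apply/sqnorm_l2; apply: l2Z; exact/sqnorm_l2.
Qed.

Lemma inHB o (w w' : seqv R) : inH o w -> inH o w' -> inH o (fun j => w j - w' j).
Proof.
case: o => [n h h' j nj|h h']; first by rewrite h // h' // subrr.
by apply/sqnorm_l2; apply: l2B; exact/sqnorm_l2.
Qed.

Lemma fip_comb m1 m2 u v (w : seqv R) p : l2 w -> l2 (u p) -> l2 (v p) ->
  cRe (fip w (comb m1 m2 u v p)) = cRe (m1 p * fip w (u p)) - cRe (m2 p * fip w (v p)).
Proof.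
move=> lw lu lv; rewrite /comb (fipB lw (@l2Z _ _ (m1 p) lu) (@l2Z _ _ (m2 p) lv)) !fipZ //.
by rewrite cReD cReN.
Qed.

Lemma comb0 m1 m2 u v p : u p = (fun=> 0) -> v p = (fun=> 0) ->
  comb m1 m2 u v p = fun=> 0.
Proof. by move=> u0 v0; apply/funext => j; rewrite /comb u0 v0 !mulr0 subrr. Qed.

Lemma comb_eq0 m1 m2 u v p (r : Cx R) : r * m1 p = 1 -> comb m1 m2 u v p = (fun=> 0) ->
  u p = fun j => m2 p * (r * v p j).
Proof.
move=> r1 /(congr1 (fun w : seqv R => w)) e; apply/funext => j.
have : comb m1 m2 u v p j = 0 by rewrite e.
move/eqP; rewrite /comb subr_eq0 => /eqP e1.
by rewrite mulrCA -e1 mulrA r1 mul1r.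
Qed.

End Combinations.

(** * Commutation of the multipliers and construction of [Gamma] *)

Section Main.
Variable R : realType.
Local Notation M := (Mn R).
Local Notation MB := (Mb R).
Variables (mu : {measure set MB -> \bar R}) (X : option nat -> set MB).
Variables (D : set (MB -> seqv R)).
Variables (Phi : (M -> Cx R) -> (MB -> seqv R) -> (MB -> seqv R)) (Omega : MB -> seqv R).
Hypothesis hX : dim_partition mu X.
Hypothesis hPhi : is_field mu X D Phi.
Hypothesis hU : forall a : M, Utr a @` D = D.
Hypothesis hcov : forall (a : M) (f : M -> Cx R), schwartz f ->
     forall psi, D psi ->
       aeeq mu (Utr a (Phi f (Utr (- a) psi))) (Phi (translate a f) psi).
Hypothesis hOmega : D Omega.
Hypothesis hinv : forall a : M, aeeq mu (Utr a Omega) Omega.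
Implicit Types (f : M -> Cx R) (psi : MB -> seqv R).

Local Notation fcut := (fibcut X).
Local Notation g := (@gaussC R).

Let dirint_Phi f : schwartz f -> dirint mu X (Phi f Omega).
Proof. by case: hPhi => _ hop _ _ /hop[+ _ _]; apply. Qed.

Let T f := fcut (Phi f Omega).

Let hvec_T f : schwartz f -> hvec mu (T f).
Proof. by move=> sf; apply: (hvec_cut hX); exact: dirint_Phi. Qed.

Lemma dirint_cut psi : dirint mu X psi -> dirint mu X (fcut psi).
Proof.
move=> hpsi; have [gc fc] := hvec_cut hX hpsi; split.
  move=> i p Xp; rewrite /fibcut asboolT; last by exists i.
  exact: hpsi.1.
by split=> //; exact: weakly_borel_gvec.
Qed.

Lemma D_cut psi : D psi -> D (fcut psi).
Proof.
case: hPhi => -[DD Dae _ _ _] _ _ _ Dpsi.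
by apply: (Dae psi) => //; [apply: dirint_cut; exact: DD|exact: (cut_ae hX)].
Qed.

Lemma D_hvec psi : D psi -> hvec mu (fcut psi).
Proof. by case: hPhi => -[DD _ _ _ _] _ _ _ /DD; exact: (hvec_cut hX). Qed.

(** Covariance at [Omega] involves [Phi f] at [Utr (- a) Omega]. By [hU] this vector is in [D],
    where [Phi f] respects a.e. equality, so invariance replaces it by [Omega]. *)
Lemma Phi_translate a f : schwartz f ->
  aeeq mu (Phi (translate a f) Omega) (Utr a (T f)).
Proof.
move=> sf; have [_ /(_ f sf)[_ hae _] _ _] := hPhi.
have DU : D (Utr (- a) Omega) by rewrite -(hU (- a)); exists Omega.
have h1 := hae _ _ DU hOmega (hinv (- a)).
have h2 := hcov a sf hOmega.
have h3 := cut_ae hX (Phi f Omega).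
apply: filterS3 h1 h2 h3 => p h1 h2 h3.
by rewrite -h2 /Utr /T -h3 -h1.
Qed.

Lemma hip_translate a f psi : schwartz f -> D psi ->
  hip mu (fcut psi) (Phi (translate a f) Omega) =
  cint mu (fun p => expi (lorentz a p) * fip (fcut psi p) (T f p)).
Proof.
move=> sf Dpsi; have [hp _] := D_hvec Dpsi.
have [hT _] := hvec_T sf.
have [ht _] := hvec_T (schwartz_translate a sf).
have gU : gvec (Utr a (T f)) by apply: gvec_mul => //; exact: cmeasurable_expi.
rewrite hip_cut (hip_ae hp ht gU); last first.
  have h1 := Phi_translate a sf; have h2 := cut_ae hX (Phi (translate a f) Omega).
  by apply: filterS2 h1 h2 => p h1 h2; rewrite -h1 h2.
have E p : fip (fcut psi p) (Utr a (T f) p) = expi (lorentz a p) * fip (fcut psi p) (T f p).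
  by rewrite /Utr fipZ //; [exact: hp.1|exact: hT.1].
by rewrite /hip /cint; congr cmk; apply: eq_Rintegral => p _; rewrite E.
Qed.

Lemma cintegrable_mul_fip (m : MB -> Cx R) f psi : cmeasurable m ->
  (exists c, forall p, `|cRe (m p)| <= c /\ `|cIm (m p)| <= c) ->
  schwartz f -> D psi ->
  cintegrable mu (fun p => m p * fip (fcut psi p) (T f p)).
Proof.
move=> mm [c Hc] sf Dpsi.
have [i1 i2] := fip_cintegrable (D_hvec Dpsi) (hvec_T sf).
have [mF1 mF2] := cmeasurableM mm (cintegrable_measurable (conj i1 i2)).
have ig : mu.-integrable setT (fun p => (c *
    (`|cRe (fip (fcut psi p) (T f p))| + `|cIm (fip (fcut psi p) (T f p))|))%:E).
  exact: (integrableZl measurableT c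
    (integrableD measurableT (integrable_abse i1) (integrable_abse i2))).
have c0 : 0 <= c by have [h _] := Hc (point : MB); exact: le_trans h.
split; apply: (le_integrable measurableT _ _ ig); try exact/measurable_EFinP.
  move=> p _ /=; rewrite lee_fin [leRHS]ger0_norm ?mulr_ge0 ?addr_ge0 // cReM.
  apply: le_trans (ler_normB _ _) _; rewrite !normrM mulrDr.
  by have [b1 b2] := Hc p; apply: lerD; apply: ler_wpM2r.
move=> p _ /=; rewrite lee_fin [leRHS]ger0_norm ?mulr_ge0 ?addr_ge0 // cImM addrC.
apply: le_trans (ler_normD _ _) _; rewrite !normrM mulrDr.
by have [b1 b2] := Hc p; apply: lerD; apply: ler_wpM2r.
Qed.

Lemma expi_bound (a : M) : exists c : R, forall p : MB,
  `|cRe (expi (lorentz a p))| <= c /\ `|cIm (expi (lorentz a p))| <= c.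
Proof. by exists 1 => p; split; [exact: norm_cos_le1|exact: norm_sin_le1]. Qed.

(** Linearity in the test function holds in matrix elements, so the sum is split inside [hip] and
    reassembled under the integral as a single multiplier. *)
Lemma hip_translates (I : Type) (s : seq I) (c : I -> Cx R) (a : I -> M) f psi :
  schwartz f -> D psi ->
  hip mu (fcut psi) (Phi (translates s c a f) Omega) =
  cint mu (fun p => (\sum_(j <- s) c j * expi (lorentz (a j) p)) * fip (fcut psi p) (T f p)).
Proof.
move=> sf Dpsi; have [_ _ hlin _] := hPhi; have Dc := D_cut Dpsi.
have -> : hip mu (fcut psi) (Phi (translates s c a f) Omega) =
    \sum_(j <- s) c j * hip mu (fcut psi) (Phi (translate (a j) f) Omega).
  elim: s => [|j s IH].
    rewrite big_nil translates_nil.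
    (* The zero function is presented as a combination of Schwartz functions, the form to which
       linearity applies. *)
    have -> : (fun=> 0 : Cx R) = fun x => 0 * f x + 0 * f x.
      by apply/funext => x; rewrite !mul0r addr0.
    by rewrite hlin // !mul0r addr0.
  rewrite big_cons -IH translates_cons hlin ?mul1r //.
    exact: schwartz_translate.
  exact: schwartz_translates.
have ii j := cintegrable_mul_fip (cmeasurable_expi (a j)) (expi_bound (a j)) sf Dpsi.
have [_] := cint_sum s (fun j => cintegrableZ (c j) (ii j)).
under eq_bigr => j _ do rewrite cintZ // -hip_translate //.
move=> <-; rewrite /cint; congr cmk; apply: eq_Rintegral => p _; congr (_ _);
  by rewrite mulr_suml; apply: eq_bigr => j _; rewrite mulrA.
Qed.

Lemma hip_ccomm n f psi : schwartz f -> D psi ->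
  hip mu (fcut psi) (Phi (ccomm f n) Omega) =
  cint mu (fun p => fourier_sum n g p * fip (fcut psi p) (T f p)) -
  cint mu (fun p => fourier_sum n f p * fip (fcut psi p) (T g p)).
Proof.
move=> sf Dpsi; have [_ _ hlin _] := hPhi; have Dc := D_cut Dpsi.
have sg := schwartz_gaussC R.
rewrite hlin //; try exact: schwartz_translates.
by rewrite !hip_translates // mul1r mulN1r.
Qed.

Lemma fourier_sum_cint_cvg f1 f2 psi : schwartz f1 -> schwartz f2 -> D psi ->
  cRe (cint mu (fun p => fourier_sum n f1 p * fip (fcut psi p) (T f2 p))) @[n --> \oo] -->
  cRe (cint mu (fun p => fourier f1 p * fip (fcut psi p) (T f2 p))).
Proof.
move=> s1 s2 Dpsi; have [c _ Hc] := fourier_sum_bound s1.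
apply: (cint_mul_cvg (c := c)).
- by move=> n; exact: cmeasurable_fsum.
- by move=> n p; exact: Hc.
- by move=> p; exact: fourier_sum_cvg.
- by apply: fip_cintegrable; [exact: D_hvec|exact: hvec_T].
Qed.

(* The two sides are the limits of the two families of Riemann sums of the
   convolution of [f] with the Gaussian. *)
Lemma weak_commutation f psi : schwartz f -> D psi ->
  cRe (cint mu (fun p => fourier g p * fip (fcut psi p) (T f p))) =
  cRe (cint mu (fun p => fourier f p * fip (fcut psi p) (T g p))).
Proof.
move=> sf Dpsi; have sg := schwartz_gaussC R; have Dc := D_cut Dpsi.
have [_ _ hlin hcont] := hPhi.
have [H _] := hcont _ _ _ _ Dc hOmega (fun n => schwartz_ccomm n sf) (@schwartz0 R) (ccomm_cvg sf).
have z : hip mu (fcut psi) (Phi (fun=> 0) Omega) = 0.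
  have -> : (fun=> 0 : Cx R) = fun x => 0 * g x + 0 * g x.
    by apply/funext => x; rewrite !mul0r addr0.
  by rewrite hlin // !mul0r addr0.
rewrite z in H.
have H' : cRe (hip mu (fcut psi) (Phi (ccomm f n) Omega)) @[n --> \oo] -->
    cRe (cint mu (fun p => fourier g p * fip (fcut psi p) (T f p))) -
    cRe (cint mu (fun p => fourier f p * fip (fcut psi p) (T g p))).
  under eq_fun do rewrite hip_ccomm // cReD cReN.
  by apply: cvgB; exact: fourier_sum_cint_cvg.
by apply/eqP; rewrite -subr_eq0; apply/eqP; exact: cvg_unique H' H.
Qed.

(** The vector that has to vanish. Both transforms are bounded and measurable, so it lies in the
    Hilbert space and density of [D] can be applied to it. *)
Let eta f : MB -> seqv R := comb (fourier g) (fourier f) (T f) (T g).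

Lemma hvec_eta f : schwartz f -> hvec mu (eta f).
Proof.
move=> sf; have sg := schwartz_gaussC R.
have [c Hc] := cabs2_fourier_bound sg; have [d Hd] := cabs2_fourier_bound sf.
exact: (hvec_comb (cmeasurable_fourier sg) (cmeasurable_fourier sf) Hc Hd (hvec_T sf) (hvec_T sg)).
Qed.

Lemma inH_T f i p : schwartz f -> X i p -> inH i (T f p).
Proof. by move=> sf; exact: (dirint_cut (dirint_Phi sf)).1. Qed.

Lemma dirint_eta f : schwartz f -> dirint mu X (eta f).
Proof.
move=> sf; have sg := schwartz_gaussC R; have [ge fe] := hvec_eta sf; split.
  move=> i p Xp.
  exact: (inHB (inHZ (fourier g p) (inH_T sf Xp)) (inHZ (fourier f p) (inH_T sg Xp))).
by split => //; exact: weakly_borel_gvec.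
Qed.

Lemma eta_orth f psi : schwartz f -> D psi ->
  Rintegral mu setT (fun p => cRe (fip (fcut psi p) (eta f p))) = 0.
Proof.
move=> sf Dpsi; have sg := schwartz_gaussC R.
have [i1 _] := cintegrable_mul_fip (cmeasurable_fourier sg) (fourier_bound sg) sf Dpsi.
have [i2 _] := cintegrable_mul_fip (cmeasurable_fourier sf) (fourier_bound sf) sg Dpsi.
have E p : cRe (fip (fcut psi p) (eta f p)) =
    cRe (fourier g p * fip (fcut psi p) (T f p)) - cRe (fourier f p * fip (fcut psi p) (T g p)).
  exact: (fip_comb _ _ ((D_hvec Dpsi).1.1 p) ((hvec_T sf).1.1 p) ((hvec_T sg).1.1 p)).
under eq_Rintegral do rewrite E.
rewrite RintegralB //; apply/eqP; rewrite subr_eq0; apply/eqP.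
exact: (weak_commutation sf Dpsi).
Qed.

(** Take [psi] in [D] close to [eta f]. The real part of their inner product is 0, so the squared
    norm of [eta f] is at most its squared distance to [psi], hence at most any positive [e]. *)
Lemma eta_ae0 f : schwartz f -> {ae mu, forall p, eta f p = fun=> 0}.
Proof.
move=> sf; have he := hvec_eta sf; have [ge fe] := he.
have small e : 0 < e -> (\int[mu]_p sqnorm (eta f p) <= e%:E)%E.
  move=> e0; have [[_ _ _ _ dens] _ _ _] := hPhi.
  have [psi [Dpsi hpsi]] := dens _ _ (dirint_eta sf) e0.
  have [gp fp] := D_hvec Dpsi.
  pose w : MB -> seqv R := fun p j => eta f p j - fcut psi p j.
  have gw : gvec w.
    split=> [p|j]; first by apply: l2B; [exact: ge.1|exact: gp.1].
    by apply: cmeasurableB; [exact: ge.2|exact: gp.2].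
  (* Off the fibres [w] is 0 while [psi] is arbitrary there, perhaps not measurable; hence a
     pointwise inequality and [ge0_integral_mono]. *)
  have iw : (\int[mu]_p sqnorm (w p) <= \int[mu]_p sqnorm (vsub (eta f) psi p))%E.
    apply: ge0_integral_mono => p; first exact: sqnorm_ge0.
    have [h|h] := pselect (fibres X p).
      have -> // : w p = vsub (eta f) psi p.
      by apply/funext => j; rewrite /w /fibcut asboolT // /vsub /vadd /vscale mulN1r.
    have -> : w p = fun=> 0.
      have c0 phi : fcut phi p = fun=> 0 by rewrite /fibcut asboolF.
      have ee : eta f p = fun=> 0 := comb0 _ _ (c0 _) (c0 _).
      by apply/funext => j; rewrite /w ee c0 subrr.
    have -> : sqnorm (fun=> 0 : Cx R) = 0%E.
      rewrite /sqnorm eseries0 // => j _ _.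
      by rewrite /cabs2 /= !expr0n addr0.
    exact: sqnorm_ge0.
  have hw : hvec mu w.
    by split => //; apply: le_lt_trans iw _; apply: lt_trans hpsi _; exact: ltry.
  have [ir _] := fip_cintegrable (conj gp fp) he.
  have i2 := integrableZl measurableT 2 ir.
  apply: le_trans (_ : (\int[mu]_p (sqnorm (w p) + 2%:E * (cRe (fip (fcut psi p) (eta f p)))%:E) <= _)%E).
    apply: le_integral => //; first exact: hvec_integrable.
      by apply: integrableD => //; exact: hvec_integrable.
    by move=> p _; apply: sqnorm_sub; [exact: ge.1|exact: gp.1].
  rewrite integralD //; last exact: hvec_integrable.
  rewrite integralZl // -[X in (_ + _ * X)%E]fineK; last exact: integrable_fin_num.
  rewrite [X in (_ + _ * X%:E)%E](eta_orth sf Dpsi) mule0 adde0.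
  by apply: le_trans iw _; exact: ltW.
have z : (\int[mu]_p sqnorm (eta f p) = 0)%E.
  apply/eqP; rewrite eq_le integral_ge0 ?andbT; last by move=> p _; exact: sqnorm_ge0.
  by apply/lee_addgt0Pr => e e0; rewrite add0e; exact: small.
have : ae_eq mu setT (fun p => sqnorm (eta f p)) (cst 0%E).
  apply/(ae_eq_integral_abs mu measurableT); first exact: measurable_sqnorm.
  by rewrite -[RHS]z; apply: eq_integral => p _; rewrite gee0_abs // sqnorm_ge0.
by apply: filterS => p /(_ I) /sqnorm_eq0.
Qed.

Let Gamma : MB -> seqv R := fun p j => cmk (gauss_hat p)^-1 0 * T g p j.

Lemma cmeasurable_gauss_hatV : cmeasurable (fun p : MB => cmk (gauss_hat p)^-1 0).
Proof.
split => /=; last exact: measurable_cst.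
have m1 : measurable_fun setT (fun p : MB => p.1.1 : R) by exact: measurableT_comp.
have m2 : measurable_fun setT (fun p : MB => p.1.2 : R) by exact: measurableT_comp.
have m3 : measurable_fun setT (fun p : MB => p.2.1 : R) by exact: measurableT_comp.
have m4 : measurable_fun setT (fun p : MB => p.2.2 : R) by exact: measurableT_comp.
pose h (q : R) := (Num.sqrt pi * expR (- (q ^+ 2 / 4)))^-1.
have mh : measurable_fun setT h.
  have -> : h = fun q => (Num.sqrt pi)^-1 * expR (q ^+ 2 / 4).
    by apply/funext => q; rewrite /h invfM -expRN opprK.
  apply: measurable_funM => //; apply: (measurableT_comp (f := @expR R)) => //.
  by apply: measurable_funM => //; exact: measurable_funX.
have -> : (fun p : MB => (gauss_hat p)^-1) = fun p => h p.1.1 * h p.1.2 * h p.2.1 * h p.2.2.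
  by apply/funext => p; rewrite /h -!invfM.
by do 3 (apply: measurable_funM; last exact: (measurableT_comp mh)); exact: (measurableT_comp mh).
Qed.

Lemma covariant_vacuum_vector : exists Gamma : MB -> seqv R,
    [/\ in_fibres X Gamma, weakly_borel X Gamma &
        forall f, schwartz f -> aeeq mu (Phi f Omega) (fun p j => fourier f p * Gamma p j)].
Proof.
have sg := schwartz_gaussC R; have [gT _] := hvec_T sg.
have gG : gvec Gamma by apply: gvec_mul => //; exact: cmeasurable_gauss_hatV.
exists Gamma; split; [|exact: weakly_borel_gvec|].
  by move=> i p Xp; exact: (inHZ (cmk (gauss_hat p)^-1 0) (inH_T sg Xp)).
move=> f sf.
(* Where [eta f] vanishes and [Phi f Omega] agrees with its cut, the identity can be divided by the
   positive number [gauss_hat p]. *)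
apply: filterS2 (eta_ae0 sf) (cut_ae hX (Phi f Omega)) => p e0 ->.
apply: (@comb_eq0 _ _ _ (T f) _ _ (cmk (gauss_hat p)^-1 0) _ e0).
rewrite fourier_gaussC /cmk; simpc.
by rewrite mulVf ?gt_eqF ?gauss_hat_gt0.
Qed.

End Main.

Theorem theorem1 (R : realType)
    (mu : {measure set (Mb R) -> \bar R})
    (X : option nat -> set (Mb R))
    (D : set (Mb R -> seqv R))
    (Phi : (Mn R -> Cx R) -> (Mb R -> seqv R) -> (Mb R -> seqv R))
    (Omega : Mb R -> seqv R) :
  dim_partition mu X ->
  is_field mu X D Phi ->
  (* covariance under the translations U *)
  (forall a : Mn R, Utr a @` D = D) ->
  (forall (a : Mn R) (f : Mn R -> Cx R), schwartz f ->
     forall psi, D psi ->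
       aeeq mu (Utr a (Phi f (Utr (- a) psi))) (Phi (translate a f) psi)) ->
  (* translation invariant vector in the domain *)
  D Omega ->
  (forall a : Mn R, aeeq mu (Utr a Omega) Omega) ->
  exists Gamma : Mb R -> seqv R,
    [/\ in_fibres X Gamma,
        weakly_borel X Gamma &
        forall f : Mn R -> Cx R, schwartz f ->
          aeeq mu (Phi f Omega) (fun p j => fourier f p * Gamma p j)].
Proof.
move=> hX hPhi hU hcov hOmega hinv.
exact: (covariant_vacuum_vector hX hPhi hU hcov hOmega hinv).
Qed.
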